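(* Let $R=R_0[X_1,\dots,X_d]$ be an $\mathbb{N}$-graded polynomial ring over a Noetherian integral domain $R_0$, and let $I_1,\dots,I_r$ be nonzero homogeneous ideals of $R$ such that $\operatorname{indeg}(I_i)\ge 1$ for at least one $i$. For $\underline{n}=(n_1,\dots,n_r)\in\mathbb{N}^r$ put $\mathbf{I}^{\underline{n}}:=I_1^{n_1}\cdots I_r^{n_r}$. Then the functions $v(R/\mathbf{I}^{\underline{n}})$, $v(\mathbf{I}^{\underline{n}}/\mathbf{I}^{\underline{n}+\underline{1}})$ and $\operatorname{indeg}(\mathbf{I}^{\underline{n}}/\mathbf{I}^{\underline{n}+\underline{1}})$ eventually become linear in $\underline{n}$ with the same leading coefficients given by $(d_1,\dots,d_r)$, where $d_i:=\operatorname{indeg}(I_i)$ for $1\le i\le r$. That is, for each of these three functions $F$ there is a constant $c_F\in\mathbb{Z}$ such that $F(\underline{n})=d_1n_1+\cdots+d_rn_r+c_F$ for all $\underline{n}\gg\underline{0}$.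
   Context: $\mathbb{N}$ includes $0$. The grading on $R$ is the one in which $R_0$ has degree $0$ and $\deg(X_i)=f_i$ for some integers $f_i\ge 0$. $\mathbb{Z}^r$ is ordered componentwise; $\underline{0}=(0,\dots,0)$, $\underline{1}=(1,\dots,1)$. A property holds ''for all $\underline{n}\gg\underline{0}$'' (eventually) if there is $\underline{m}\in\mathbb{N}^r$ such that it holds for all $\underline{n}\ge\underline{m}$. For a $\mathbb{Z}$-graded module $L$, the initial degree is $\operatorname{indeg}(L):=\inf\{n\in\mathbb{Z}:L_n\ne0\}$, with $\operatorname{indeg}(0)=+\infty$. For a finitely generated $\mathbb{Z}$-graded $R$-module $L$ and $\mathfrak{p}\in\operatorname{Ass}_R(L)$, the local $v$-number is $v_{\mathfrak{p}}(L):=\inf\{n\in\mathbb{Z}:\text{there exists }x\in L_n\text{ such that }\mathfrak{p}=(0:_R x)\}$, and the $v$-number is $v(L):=\inf\{v_{\mathfrak{p}}(L):\mathfrak{p}\in\operatorname{Ass}_R(L)\}$, with $v(0)=\infty$. *)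

(* Defs.v *)
From HB Require Import structures.
From mathcomp Require Import all_boot all_order all_algebra.
From mathcomp Require Import mpoly.
From mathcomp Require Import boolp classical_sets constructive_ereal.

Set Implicit Arguments.
Unset Strict Implicit.
Unset Printing Implicit Defensive.

Import Order.TTheory GRing.Theory Num.Theory.

Local Open Scope classical_set_scope.
Local Open Scope ring_scope.
Local Open Scope quotient_scope.

(* Infimum in Z extended by -oo and +oo; [einf_glb] shows that it is the
   greatest lower bound of every set (+oo for the empty set). *)
Definition einf (S : set (\bar int)) : \bar int := infimum +oo%E S.

Lemma einf_exists (S : set (\bar int)) : infimums S !=set0.
Proof.
have [Snoo|Snoo] := pselect (lbound S `<=` [set -oo%E]).
  exists -oo%E; split=> [y _|y /Snoo ->]; by rewrite ?leNye.
have {Snoo} [b lb_b b_noo] : exists2 b : \bar int, lbound S b & b <> -oo%E.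
  apply: contrapT => h; apply: Snoo => b lb_b /=.
  by apply: contrapT => bn; apply: h; exists b.
have [S0|[x Sx xfin]] : S `<=` [set +oo%E] \/ exists2 x, S x & x <> +oo%E.
- have [?|h] := pselect (exists2 x, S x & x <> +oo%E); [by right|left].
  move=> x Sx /=; apply: contrapT => xn; apply: h; by exists x.
- exists +oo%E; split=> [y /S0 ->//|y _]; exact: leey.
case: b lb_b b_noo => [b lb_b _|lb_b _|//]; last first.
  by move: (lb_b _ Sx); rewrite leye_eq => /eqP.
case: x Sx xfin => [x Sx _|//|Sx _]; last first.
  by move: (lb_b _ Sx); rewrite leeNy_eq.
have bx : b <= x by have := lb_b _ Sx; rewrite lee_fin.
have ex : exists k : nat, `[< S (b + k%:Z)%:E >].
  exists `|x - b|%N; apply/asboolP.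
  by rewrite gez0_abs ?subr_ge0 // [b + _]addrC subrK.
case: (ex_minnP ex) => k /asboolP Sk kmin.
exists (b + k%:Z)%:E; split=> [y Sy|y lby]; last exact: lby.
case: y Sy => [y Sy|_|Sy]; [|exact: leey|by move: (lb_b _ Sy)].
have by_ : b <= y by have := lb_b _ Sy; rewrite lee_fin.
have : `[< S (b + (`|y - b|%N)%:Z)%:E >].
  by apply/asboolP; rewrite gez0_abs ?subr_ge0 // [b + _]addrC subrK.
move=> /kmin; rewrite lee_fin -lez_nat gez0_abs ?subr_ge0 //.
by rewrite lerBrDl.
Qed.

Lemma einf_glb (S : set (\bar int)) : infimums S (einf S).
Proof.
rewrite /einf /infimum; case: ifPn => [/eqP ->|_].
  by split=> [y []|y _]; exact: leey.
by case: xgetP => [y _ //|h]; have [y /h] := einf_exists S.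
Qed.

Section Modules.
Variable A : comNzRingType.
Implicit Types V L : lmodType A.

Record submodule V := Submodule {
  submodule_set :> V -> Prop;
  submodule0 : submodule_set 0;
  submoduleP : forall (a : A) u v,
    submodule_set u -> submodule_set v -> submodule_set (a *: u + v) }.

Definition top_submodule V : submodule V := @Submodule V setT I (fun _ _ _ _ _ => I).

Definition submodule_mem V (M : submodule V) : pred V := fun x => `[< M x >].

Lemma submodule_mem_closed V (M : submodule V) : submod_closed (submodule_mem M).
Proof.
split=> [|a u v]; first by apply/asboolP/submodule0.
by move=> /asboolP Mu /asboolP Mv; apply/asboolP/submoduleP.
Qed.

HB.instance Definition _ V (M : submodule V) :=
  GRing.isSubmodClosed.Build A V (submodule_mem M) (submodule_mem_closed M).

Definition submod V (M : submodule V) : Type := {x : V | submodule_mem M x}.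

HB.instance Definition _ V (M : submodule V) := SubChoice.on (submod M).
HB.instance Definition _ V (M : submodule V) :=
  [SubChoice_isSubLmodule of submod M by <:].

Definition quotmod V (N : submodule V) : Type :=
  Quotient.quot (GRing.ZmodClosed.clone V (submodule_mem N) _).

HB.instance Definition _ V (N : submodule V) :=
  ZmodQuotient.on (quotmod N).

Section QuotientScale.
Variables (V : lmodType A) (N : submodule V).
Local Notation Q := (quotmod N).

Lemma quotmod_eqE (x y : V) :
  (\pi_Q x = \pi_Q y) <-> N (x - y).
Proof.
split=> [/eqP|Nxy]; first by rewrite -Quotient.idealrBE => /asboolP.
by apply/eqP; rewrite -Quotient.idealrBE; apply/asboolP.
Qed.

Definition quotmod_scale (a : A) (x : Q) : Q := \pi_Q (a *: repr x).

Lemma quotmod_scale_pi a (x : V) : quotmod_scale a (\pi_Q x) = \pi_Q (a *: x).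
Proof.
apply/quotmod_eqE; rewrite -scalerBr -[_ *: _]addr0.
apply: submoduleP; last exact: submodule0.
by apply/quotmod_eqE; rewrite reprK.
Qed.

Lemma quotmod_scaleA a b x :
  quotmod_scale a (quotmod_scale b x) = quotmod_scale (a * b) x.
Proof.
by rewrite -[x]reprK (quotmod_scale_pi b) !quotmod_scale_pi scalerA.
Qed.

Lemma quotmod_scale1 : left_id 1 quotmod_scale.
Proof. by move=> x; rewrite -[x]reprK quotmod_scale_pi scale1r. Qed.

Lemma quotmod_scaleDr : right_distributive quotmod_scale +%R.
Proof.
move=> a x y; rewrite -[x]reprK -[y]reprK -raddfD !quotmod_scale_pi.
by rewrite -raddfD scalerDr.
Qed.

Lemma quotmod_scaleDl x : {morph quotmod_scale^~ x : a b / a + b}.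
Proof.
by move=> a b; rewrite -[x]reprK !quotmod_scale_pi -raddfD scalerDl.
Qed.

HB.instance Definition _ := GRing.Zmodule_isLmodule.Build A Q
  quotmod_scaleA quotmod_scale1 quotmod_scaleDr quotmod_scaleDl.

Lemma quotmod_piZ a (x : V) : \pi_Q (a *: x) = a *: \pi_Q x.
Proof. by rewrite -quotmod_scale_pi. Qed.

End QuotientScale.

Lemma submod_restrict_subproof V (M N : submodule V) a (u v : submod M) :
  N (val u) -> N (val v) -> N (val (a *: u + v)).
Proof. exact: submoduleP. Qed.

(* The trace of N on M, as a submodule of M; when N is contained in M, the
   quotient M / N is [quotmod (submod_restrict M N)] *)
Definition submod_restrict V (M N : submodule V) : submodule (submod M) :=
  @Submodule (submod M) (fun x => N (val x)) (submodule0 N)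
    (@submod_restrict_subproof V M N).

Definition ideal := submodule (A^o : lmodType A).

Definition ann_set V (x : V) : A -> Prop := fun a => a *: x = 0.

Definition prime_ideal (p : ideal) : Prop :=
  ~ p 1 /\ forall a b : A, p (a * b) -> p a \/ p b.

Definition Ass L (p : ideal) : Prop :=
  prime_ideal p /\ exists x : L, submodule_set p = ann_set x.

Definition noetherian : Prop :=
  forall J : ideal, exists s : seq A, forall x : A,
    J x <-> exists c : nat -> A, x = \sum_(i < size s) c i * s`_i.

Definition ideal_mul_set (J K : ideal) : A -> Prop := fun x =>
  exists2 s : seq (A * A), (forall u, u \in s -> J u.1 /\ K u.2) &
    x = \sum_(u <- s) u.1 * u.2.

Definition ideal_mul (J K : ideal) : ideal.
Proof.
exists (ideal_mul_set J K) => [|a x y [s sP ->] [t tP ->]].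
  by exists [::]; rewrite ?big_nil.
exists ([seq (a * u.1, u.2) | u <- s] ++ t) => [u|].
  rewrite mem_cat => /orP[/mapP[w /sP[Jw Kw] ->]|/tP//]; split=> //=.
  by rewrite -[a * _]addr0; apply: (@submoduleP _ J a) => //; exact: submodule0.
rewrite big_cat big_map /= scaler_sumr; congr (_ + _).
by apply: eq_bigr => u _; rewrite -mulrA.
Defined.

Definition ideal_one : ideal := top_submodule A^o.

Definition ideal_exp (J : ideal) (n : nat) : ideal :=
  iter n (ideal_mul J) ideal_one.

(* I_1 ^ n_1 ... I_r ^ n_r *)
Definition ideal_mexp r (J : 'I_r -> ideal) (n : 'I_r -> nat) : ideal :=
  \big[ideal_mul/ideal_one]_(i < r) ideal_exp (J i) (n i).

(* A Z-grading of L is given by its homogeneous components. *)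
Definition grading L := int -> set L.

Definition sub_grading V (gr : grading V) (M : submodule V) :
  grading (submod M) := fun k => [set x | gr k (val x)].

Definition quot_grading V (gr : grading V) (N : submodule V) :
  grading (quotmod N) := fun k => [set \pi_(quotmod N) x | x in gr k].

Definition indeg L (gr : grading L) : \bar int :=
  einf [set k%:E | k in [set k | exists2 x, gr k x & x <> 0]].

Definition local_vnumber L (gr : grading L) (p : ideal) : \bar int :=
  einf [set k%:E |
    k in [set k | exists2 x, gr k x & submodule_set p = ann_set x]].

Definition vnumber L (gr : grading L) : \bar int :=
  einf [set local_vnumber gr p | p in Ass L].

End Modules.

Arguments sub_grading {A V} gr M _ _.
Arguments quot_grading {A V} gr N _ _.

Section Graded.
Variables (R0 : idomainType) (d : nat) (f : 'I_d -> nat).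
Local Notation R := {mpoly R0[d]}.

(* The degree of a monomial when 'X_i has degree f i *)
Definition wdeg (m : 'X_{1..d}) : nat := (\sum_(i < d) m i * f i)%N.

Lemma wdeg0 : wdeg 0%MM = 0%N.
Proof. by rewrite /wdeg big1 // => i _; rewrite mnm0E. Qed.

Lemma wdegD : {morph wdeg : m1 m2 / (m1 + m2)%MM >-> (m1 + m2)%N}.
Proof.
move=> m1 m2; rewrite /wdeg -big_split /=.
by apply: eq_bigr => i _; rewrite mnmDE mulnDl.
Qed.

HB.instance Definition _ := isMeasure.Build d wdeg wdeg0 wdegD.

Definition mpoly_grading : grading (R^o : lmodType R) := fun k =>
  match k with
  | Posz n => [set p : R | p \is n.-homog for wdeg]
  | Negz _ => [set 0]
  end.

Definition homogeneous_ideal (J : ideal R) : Prop :=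
  forall (p : R) (k : nat), J p -> J (pihomog wdeg k p).

Definition indeg_ideal (J : ideal R) : \bar int :=
  indeg (sub_grading mpoly_grading J).

Definition vnumber_quot (J : ideal R) : \bar int :=
  vnumber (quot_grading mpoly_grading J).

Definition subquot_grading (J K : ideal R) :
    grading (quotmod (submod_restrict J K)) :=
  quot_grading (sub_grading mpoly_grading J) (submod_restrict J K).
Arguments subquot_grading : clear implicits.

(* v(J / K) and indeg(J / K), for K contained in J *)
Definition vnumber_subquot (J K : ideal R) : \bar int :=
  vnumber (subquot_grading J K).

Definition indeg_subquot (J K : ideal R) : \bar int :=
  indeg (subquot_grading J K).

End Graded.

Definition eventually_linear r (e : 'I_r -> int)
    (F : ('I_r -> nat) -> \bar int) : Prop :=
  exists (c : int) (m : 'I_r -> nat), forall n : 'I_r -> nat,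
    (forall i, (m i <= n i)%N) -> F n = (\sum_(i < r) e i * (n i)%:Z + c)%:E.

(* Main.v *)
Require Import Defs.
From HB Require Import structures.
From mathcomp Require Import all_boot all_order all_algebra.
From mathcomp Require Import mpoly zify.
From mathcomp Require Import boolp classical_sets constructive_ereal.

(** Write [I ^^ n] for the product of the powers [I_i ^ n_i], [D n] for
    [\sum_i d_i n_i], and [ones] for the index with all components [1]. As [R] is a domain, the least degree of a nonzero element
    of [I ^^ n] is [D n], attained by products of elements [a_i] of degree
    [d_i] in [I_i]; and since some [d_i] is positive, these products lie outside
    [I ^^ (n + ones)]. This already gives the initial degree of the
    subquotient, with constant term [0].

    For the [v]-number of [I ^^ n / I ^^ (n + ones)] it then suffices to see that
    its excess over [D n], which is a natural number, is bounded and does not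
    increase when [n] grows by one in a direction [j], for large [n]: the
    least value of the excess persists from the point where it is first
    attained ([eventually_min_linear]).

    - Bounded ([prime_witness_bounded]). The annihilators of the products
      [apow n] of the [a_i] modulo [I ^^ (n + ones)] grow with [n], so they
      are constant for large [n]; an associated prime [(J : g)] of their common
      value [J] is the annihilator of [g * apow n] for all large [n].

    - Nonincreasing ([prime_witness_persists]). Let [p] be the prime annihilator
      of [x], of excess [delta]. If some element [a] of degree [d_j] in [I_j] is
      such that [a * x] still has annihilator [p], the excess [delta] is
      attained in the next degree. Otherwise [x] is called bad; a product of
      elements outside [p], one for each generator [a], then kills all [a * x].
      For a fixed excess, Noetherianity of the Rees algebra writes the bad
      elements in terms of finitely many bad elements [x_l] with coefficients of
      least degree ([rees_finite_basis_homog]). In large degrees each [f_l * x_l]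
      in such a combination is killed by [ann x_l] and by an element outside it,
      whence [p] strictly contains some [ann x_l] ([bad_step]).
      Noetherian induction on primes then bounds the degrees of bad
      elements ([bad_bounded]).

    For [R / I ^^ n], if [(I ^^ n : x)] is prime it contains some [I_i], so that
    [I_i x] lies in [I ^^ n] and Ratliff's theorem ([ratliff]) puts [x] in
    [I ^^ (n - U_(i))]. Hence the [v]-number of [R / I ^^ n] is eventually
    the least of those of the subquotients [I ^^ (n - U_(i)) / I ^^ n], to which
    the second argument applies, and the first one still bounds it since
    [I ^^ (n - ones) / I ^^ n] embeds in [R / I ^^ n]. *)

Set Implicit Arguments.
Unset Strict Implicit.
Unset Printing Implicit Defensive.

Import Order.TTheory GRing.Theory Num.Theory.

Local Open Scope ring_scope.

(** * Hilbert's basis theorem *)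

Section Noetherian.
Variable T : comNzRingType.
Implicit Types (S B : T -> Prop) (L : seq T).

Definition lincomb S B (x : T) : Prop :=
  exists2 s : seq (T * T), (forall u, u \in s -> S u.1 /\ B u.2) &
    x = \sum_(u <- s) u.1 * u.2.

Definition subring S : Prop :=
  [/\ S 1, forall x y, S x -> S y -> S (x - y) &
      forall x y, S x -> S y -> S (x * y)].

(** Noetherianity of a subring [S], in the form used throughout: generators of
    an arbitrary subset [B], not only of an ideal, are found inside [B].
    Being relative to [S], it applies to Rees algebras without a type for them. *)
Definition noetherian_in S : Prop :=
  forall B, (forall x, B x -> S x) ->
  exists2 L : seq T, (forall x, x \in L -> B x) &
    forall x, B x -> lincomb S (fun y => y \in L) x.

Lemma subring0 S : subring S -> S 0.
Proof. by case=> S1 SB _; rewrite -(subrr 1); apply: SB. Qed.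

Lemma subringD S x y : subring S -> S x -> S y -> S (x + y).
Proof.
move=> rS Sx Sy; have S0 := subring0 rS; case: rS => _ SB _.
by rewrite -[y]opprK; apply: (SB) => //; rewrite -[- y]sub0r; apply: SB.
Qed.

Lemma subring_sum S (I : eqType) (s : seq I) (F : I -> T) :
  subring S -> (forall i, i \in s -> S (F i)) -> S (\sum_(i <- s) F i).
Proof.
move=> rS SF; rewrite big_seq; apply: (big_ind S) => //.
  exact: subring0.
by move=> x y; apply: subringD.
Qed.

Lemma lincomb0 S B : lincomb S B 0.
Proof. by exists [::]; rewrite ?big_nil. Qed.

Lemma lincombD S B x y : lincomb S B x -> lincomb S B y -> lincomb S B (x + y).
Proof.
move=> [s sP ->] [t tP ->]; exists (s ++ t); last by rewrite big_cat.
by move=> u; rewrite mem_cat => /orP[/sP|/tP].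
Qed.

Lemma lincomb_sum S B (I : eqType) (s : seq I) (F : I -> T) :
  (forall i, i \in s -> lincomb S B (F i)) -> lincomb S B (\sum_(i <- s) F i).
Proof.
move=> SF; rewrite big_seq; apply: (big_ind (lincomb S B)) => //.
  exact: lincomb0.
exact: lincombD.
Qed.

Lemma lincombZ S B a x : subring S -> S a -> lincomb S B x ->
  lincomb S B (a * x).
Proof.
move=> [_ _ SM] Sa [s sP ->]; exists [seq (a * u.1, u.2) | u <- s].
  by move=> u /mapP[w /sP[Sw Bw] ->]; split=> //; apply: SM.
by rewrite big_map mulr_sumr; apply: eq_bigr => u _; rewrite mulrA.
Qed.

Lemma lincomb_gen S B x : subring S -> B x -> lincomb S B x.
Proof.
move=> [S1 _ _] Bx; exists [:: (1, x)]; last by rewrite big_seq1 mul1r.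
by move=> u; rewrite inE => /eqP ->.
Qed.

Lemma lincombB S B x y : subring S -> lincomb S B x -> lincomb S B y ->
  lincomb S B (x - y).
Proof.
move=> rS Bx By; apply: lincombD => //; rewrite -mulN1r; apply: lincombZ => //.
have S0 := subring0 rS; case: rS => S1 SB _; rewrite -sub0r; exact: SB.
Qed.

Lemma lincomb_trans S B B' x : subring S ->
  (forall y, B y -> lincomb S B' y) -> lincomb S B x -> lincomb S B' x.
Proof.
move=> rS BB' [s sP ->]; apply: lincomb_sum => u /sP[Su Bu].
by apply: lincombZ => //; apply: BB'.
Qed.

Lemma lincomb_mono S B B' x :
  (forall y, B y -> B' y) -> lincomb S B x -> lincomb S B' x.
Proof. by move=> BB' [s sP ->]; exists s => // u /sP[Su /BB']. Qed.

Lemma lincomb_sub S B x : subring S -> (forall y, B y -> S y) ->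
  lincomb S B x -> S x.
Proof.
move=> rS BS [s sP ->]; apply: subring_sum => // u /sP[Su Bu].
by case: rS => _ _; apply=> //; apply: BS.
Qed.

(** Only finitely many elements of [B] enter finitely many combinations. *)
Lemma lincomb_finite S B L : (forall x, x \in L -> lincomb S B x) ->
  exists2 K : seq T, (forall x, x \in K -> B x) &
    forall x, x \in L -> lincomb S (fun y => y \in K) x.
Proof.
elim: L => [|x L IHL] LB; first by exists [::].
have [|K KB LK] := IHL; first by move=> y yL; apply: LB; rewrite inE yL orbT.
have [s sP xE] := LB x (mem_head x L).
exists ([seq u.2 | u <- s] ++ K) => [y|y].
  by rewrite mem_cat => /orP[/mapP[u /sP[_ Bu] ->]|/KB].
rewrite inE => /orP[/eqP ->|/LK]; last first.
  by apply: lincomb_mono => z zK; rewrite mem_cat zK orbT.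
exists s => // u us; split; first by case: (sP u us).
by rewrite mem_cat map_f.
Qed.

End Noetherian.

Lemma noetherian_in_image (T T' : comNzRingType) (phi : {rmorphism T -> T'})
    (S : T -> Prop) : noetherian_in S ->
  noetherian_in (fun y => exists2 x, S x & y = phi x).
Proof.
move=> nS B BS.
have [|L LB LP] := nS (fun x => S x /\ B (phi x)); first by move=> x [].
exists [seq phi x | x <- L] => [y /mapP[x /LB[_ Bx] ->] //|y By].
have [x Sx yE] := BS y By.
have [|s sP xE] := LP x; first by rewrite -yE.
exists [seq (phi u.1, phi u.2) | u <- s] => [u /mapP[w /sP[Sw wL] ->]|].
  by split; [exists w.1|exact: map_f].
by rewrite yE xE rmorph_sum big_map; apply: eq_bigr => u _; rewrite rmorphM.
Qed.

Section HilbertBasis.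
Variables (T : comNzRingType) (S : T -> Prop).
Hypotheses (rS : subring S) (nS : noetherian_in S).

Definition poly_in (p : {poly T}) : Prop := forall i, S p`_i.

Lemma poly_in_subring : subring poly_in.
Proof.
have S0 := subring0 rS; have [S1 SB SM] := rS.
split=> [i|p q Sp Sq i|p q Sp Sq i].
- by rewrite coef1; case: (_ == _).
- by rewrite coefB; apply: SB.
- by rewrite coefM; apply: subring_sum => // j _; apply: SM.
Qed.

Lemma poly_in_scaleXn (a : T) k : S a -> poly_in (a *: 'X^k).
Proof.
move=> Sa i; rewrite coefZ coefXn; case: (_ == _); rewrite ?mulr1 ?mulr0 //.
exact: subring0.
Qed.

(** Finitely many polynomials of the ideal realise generators of the ideal of
    all leading coefficients, and of the ideals of leading coefficients in each
    degree below theirs; cancelling the leading term of any other polynomial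
    of the ideal against them lowers its degree. *)
Lemma hilbert_basis : noetherian_in poly_in.
Proof.
move=> B BS; have rP := poly_in_subring.
pose J := lincomb poly_in B.
have JP p : J p -> poly_in p by apply: lincomb_sub.
pose C n a := exists2 p, J p & (size p <= n.+1)%N /\ p`_n = a.
have CS n a : C n a -> S a by case=> p /JP Sp [_ <-].
(* [lead K n a]: some combination of [K] has leading term [a 'X^n] *)
pose lead (K : seq {poly T}) n a :=
  exists2 p, lincomb poly_in (fun q => q \in K) p & (size p <= n.+1)%N /\ p`_n = a.
have leadD K n a b : lead K n a -> lead K n b -> lead K n (a + b).
  move=> [p Kp [sp <-]] [q Kq [sq <-]]; exists (p + q); first exact: lincombD.
  by rewrite coefD (leq_trans (size_polyD _ _)) // geq_max sp sq.
have leadZ K m n c a : (m <= n)%N -> S c -> lead K m a -> lead K n (c * a).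
  move=> mn Sc [p Kp [sp <-]]; exists (c *: 'X^(n - m) * p).
    by apply: lincombZ => //; apply: poly_in_scaleXn.
  rewrite -scalerAl coefZ coefXnM ltnNge leq_subr /= subKn //; split=> //.
  rewrite (leq_trans (size_scale_leq _ _)) // (leq_trans (size_polyMleq _ _)) //.
  by rewrite size_polyXn /= -{2}(subnK mn) -addnS leq_add2l.
have lead_comb K n x (A : T -> Prop) : (forall a, A a -> exists2 m, (m <= n)%N & lead K m a) ->
    lincomb S A x -> lead K n x.
  move=> AK [s sP ->]; rewrite big_seq; apply: (big_ind (lead K n)).
  - exists 0; first exact: lincomb0.
    by rewrite size_poly0 coef0.
  - exact: leadD.
  - by move=> u /sP[Su /AK[m mn Km]]; apply: leadZ Km.
have leadS K K' n a : {subset K <= K'} -> lead K n a -> lead K' n a.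
  by move=> KK' [p Kp pE]; exists p => //; apply: lincomb_mono Kp => q /KK'.
have gather (A : seq (nat * T)) : (forall u, u \in A -> C u.1 u.2) ->
    exists2 K : seq {poly T}, (forall p, p \in K -> J p) &
      forall u, u \in A -> lead K u.1 u.2.
  elim: A => [|u A IHA] AC; first by exists [::].
  have [|K KJ AK] := IHA; first by move=> v vA; apply: AC; rewrite inE vA orbT.
  have [p Jp pE] := AC u (mem_head u A).
  exists (p :: K) => [q|v].
    by rewrite inE => /orP[/eqP ->|/KJ].
  rewrite inE => /orP[/eqP ->|/AK].
    by exists p => //; apply: lincomb_gen => //; rewrite mem_head.
  by apply: leadS => q qK; rewrite inE qK orbT.
(* leading coefficients regardless of the degree: usable above the degrees [deg] *)
have [Ainf AC Agen] : exists2 A : seq T,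
    (forall a, a \in A -> exists n, C n a) &
    forall a, (exists n, C n a) -> lincomb S (fun b => b \in A) a.
  by apply: nS => a [n /CS].
have /choice[deg degP] : forall a, exists n, a \in Ainf -> C n a.
  move=> a; have [/AC[n Cna]|_] := boolP (a \in Ainf); first by exists n.
  by exists 0%N.
have [|K1 K1J K1P] := gather [seq (deg a, a) | a <- Ainf].
  by move=> u /mapP[a aA ->]; apply: degP.
pose N := \max_(a <- Ainf) deg a.
have high n a : (N <= n)%N -> C n a -> lead K1 n a.
  move=> Nn Ca; have {Ca} : lincomb S (fun b => b \in Ainf) a by apply: Agen; exists n.
  move=> comb; apply: (lead_comb) comb => b bA; exists (deg b); last first.
    by apply: (K1P (deg b, b)); apply/mapP; exists b.
  by apply: leq_trans Nn; rewrite /N; apply: leq_bigmax_seq.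
(* below [N], one finite list for each degree *)
have [K2 K2J low] : exists2 K : seq {poly T}, (forall p, p \in K -> J p) &
    forall n a, (n < N)%N -> C n a -> lead K n a.
  elim: N {high} => [|M [K KJ KP]]; first by exists [::].
  have [A ACM Agen'] := nS (CS M).
  have [|K' K'J K'P] := gather [seq (M, a) | a <- A].
    by move=> u /mapP[a /ACM ? ->].
  exists (K ++ K') => [p|n a]; first by rewrite mem_cat => /orP[/KJ|/K'J].
  rewrite ltnS leq_eqVlt => /orP[/eqP -> /Agen'|nM /(KP n a nM)]; last first.
    by apply: leadS => p pK; rewrite mem_cat pK.
  move=> comb; apply: (lead_comb) comb => b bA; exists M => //.
  have Mb : (M, b) \in [seq (M, a) | a <- A] by apply/mapP; exists b.
  by apply: leadS (K'P _ Mb) => p pK; rewrite mem_cat pK orbT.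
pose K := K1 ++ K2.
have KJ p : p \in K -> J p by rewrite mem_cat => /orP[/K1J|/K2J].
have leadK n a : C n a -> lead K n a.
  have [nN /(low _ _ nN)|Nn /(high _ _ Nn)] := ltnP n N;
    by apply: leadS => p pK; rewrite mem_cat pK ?orbT.
have reduce n (p : {poly T}) : (size p <= n)%N -> J p -> lincomb poly_in (fun q => q \in K) p.
  elim: n p => [|n IHn] p sp Jp.
    by move: sp; rewrite leqn0 size_poly_eq0 => /eqP ->; apply: lincomb0.
  have [|q Kq [sq qp]] := leadK n p`_n; first by exists p.
  rewrite -(subrK q p); apply: lincombD => //; apply: IHn; last first.
    by apply: lincombB => //; apply: lincomb_trans Kq.
  apply/leq_sizeP => j nj; rewrite coefB.
  have [->|jn] := eqVneq j n; first by rewrite qp subrr.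
  have {}nj : (n < j)%N by rewrite ltn_neqAle eq_sym jn.
  by rewrite (leq_sizeP _ _ sp) ?(leq_sizeP _ _ sq) ?subr0.
have [L LB LK] := lincomb_finite KJ.
exists L => // p Bp; apply: (lincomb_trans rP LK).
by apply: (reduce (size p)) => //; apply: lincomb_gen.
Qed.

End HilbertBasis.

(** [S[t]] is the image of [S[X]] under evaluation at [t]. *)
Lemma noetherian_adjoin (T : comNzRingType) (S : T -> Prop) (t : T) :
  subring S -> noetherian_in S ->
  exists S' : T -> Prop, [/\ subring S', noetherian_in S', forall x, S x -> S' x,
    S' t & forall U : T -> Prop, subring U -> (forall x, S x -> U x) -> U t ->
      forall x, S' x -> U x].
Proof.
move=> rS nS; have [P1 PB PM] := poly_in_subring rS.
exists (fun x => exists2 p, poly_in S p & x = horner_eval t p); split.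
- split; first by exists 1 => //; rewrite rmorph1.
    by move=> _ _ [p Sp ->] [q Sq ->]; exists (p - q); rewrite ?rmorphB //; apply: PB.
  by move=> _ _ [p Sp ->] [q Sq ->]; exists (p * q); rewrite ?rmorphM //; apply: PM.
- exact/noetherian_in_image/hilbert_basis.
- move=> x Sx; exists (x *: 'X^0); first exact: poly_in_scaleXn.
  by rewrite /horner_eval expr0 alg_polyC hornerC.
- exists (1 *: 'X^1); first by apply: poly_in_scaleXn => //; case: rS.
  by rewrite /horner_eval scale1r hornerX.
- move=> U rU SU Ut _ [p Sp ->]; rewrite /horner_eval horner_coef.
  have [U1 _ UM] := rU; apply: subring_sum => // i _; apply: (UM); first exact/SU/Sp.
  by elim: (nat_of_ord i) => [|k IHk]; rewrite ?expr0 // exprS; apply: UM.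
Qed.

(** Hilbert's basis theorem for finitely generated algebras: the last clause
    identifies the ring as the one generated by [S] and [l]. *)
Lemma noetherian_adjoin_seq (T : comNzRingType) (S : T -> Prop) (l : seq T) :
  subring S -> noetherian_in S ->
  exists S' : T -> Prop, [/\ subring S', noetherian_in S', forall x, S x -> S' x,
    forall t, t \in l -> S' t &
    forall U : T -> Prop, subring U -> (forall x, S x -> U x) ->
      (forall t, t \in l -> U t) -> forall x, S' x -> U x].
Proof.
move=> rS nS; elim: l => [|t l [S1 [rS1 nS1 SS1 lS1 minS1]]].
  by exists S; split.
have [S2 [rS2 nS2 S12 S2t minS2]] := noetherian_adjoin t rS1 nS1.
exists S2; split=> // [x /SS1/S12 //|u|U rU SU lU x].
  by rewrite inE => /orP[/eqP ->|/lS1/S12].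
apply: minS2 => //; last by apply: lU; rewrite mem_head.
by move=> y; apply: minS1 => // u ul; apply: lU; rewrite inE ul orbT.
Qed.

Lemma noetherian_inT (A : comNzRingType) :
  noetherian A -> noetherian_in (fun _ : A => True).
Proof.
move=> nA B _; pose S (x : A) := True.
have rS : subring S by [].
have J0 : lincomb S B 0 by apply: lincomb0.
pose J : ideal A := @Submodule A A^o (lincomb S B) J0
  (fun a u v Bu Bv => lincombD (lincombZ rS I Bu) Bv).
have [s sP] := nA J.
have sJ x : x \in s -> lincomb S B x.
  move=> /(nthP 0)[i ilt <-]; apply/(sP s`_i).
  exists (fun j => (j == i)%:R); rewrite (bigD1 (Ordinal ilt)) //= eqxx mul1r.
  rewrite big1 ?addr0 // => j; rewrite -val_eqE /= => /negPf ->.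
  by rewrite mul0r.
have [L LB Ls] := lincomb_finite sJ; exists L => // x Bx.
have /(sP x)[c ->] : J x by apply: lincomb_gen.
apply: (@lincomb_sum _ S) => i _; apply: lincombZ => //.
by apply: Ls; rewrite mem_nth.
Qed.

Lemma mpoly_noetherian (A : comNzRingType) (d : nat) :
  noetherian A -> noetherian_in (fun _ : {mpoly A[d]} => True).
Proof.
move=> /noetherian_inT nA.
pose S (y : {mpoly A[d]}) := exists2 x : A, True & y = x%:MP.
have nS : noetherian_in S by apply: noetherian_in_image nA.
have rS : subring S.
  split; first by exists 1.
    by move=> _ _ [x _ ->] [y _ ->]; exists (x - y); rewrite ?rmorphB.
  by move=> _ _ [x _ ->] [y _ ->]; exists (x * y); rewrite ?rmorphM.
have [S' [rS' nS' SS' XS' _]] := noetherian_adjoin_seq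
  [seq 'X_i | i <- enum 'I_d] rS nS.
suff S'T p : S' p.
  move=> B _; have [//|L LB LP] := nS' B; exists L => // x /LP.
  by case=> s sP ->; exists s => // u /sP[].
have [S'1 _ S'M] := rS'; rewrite [p]mpolyE; apply: subring_sum => // m _.
rewrite -mul_mpolyC; apply: (S'M); first by apply: SS'; exists p@_m.
rewrite mpolyXE_id; apply: (big_ind S') => // i _.
have S'X : S' 'X_i by apply: XS'; apply/mapP; exists i; rewrite ?mem_enum.
by elim: (m i) => [|k IHk]; rewrite ?expr0 // exprS; apply: S'M.
Qed.

(** Without a maximal element there would be a strictly increasing sequence of
    ideals; the generators of its union would already lie in one of them. *)
Lemma noetherian_max (A : comNzRingType) (X : Type) (F : X -> ideal A)
    (P : X -> Prop) :
  noetherian_in (fun _ : A => True) -> (exists x, P x) ->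
  exists2 x, P x &
    forall y, P y -> (forall a, F x a -> F y a) -> forall a, F y a -> F x a.
Proof.
move=> nA [x0 Px0]; apply: contrapT => noMax.
have step (x : {x | P x}) : exists y : {x | P x},
    (forall a, F (sval x) a -> F (sval y) a) /\
    exists2 a, F (sval y) a & ~ F (sval x) a.
  case: x => x Px /=; apply: contrapT => noy; apply: noMax; exists x => // y Py xy a Fya.
  by apply: contrapT => nFxa; apply: noy; exists (exist _ y Py); split=> //; exists a.
have [next nextP] := choice step.
pose G k := F (sval (iter k next (exist _ x0 Px0))).
have Gmono j k a : (j <= k)%N -> G j a -> G k a.
  move=> /subnK <-; elim: (k - j)%N => // i IHi /IHi Ga.
  by case: (nextP (iter (i + j) next (exist _ x0 Px0))) => + _; apply.
have [//|L LG Lgen] := nA (fun a => exists k, G k a).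
have [N NP] : exists N, forall a, a \in L -> G N a.
  elim: L LG {Lgen} => [|a L IHL] LG; first by exists 0%N.
  have [|N NP] := IHL; first by move=> b bL; apply: LG; rewrite inE bL orbT.
  have [M GMa] := LG a (mem_head a L); exists (maxn M N) => b.
  rewrite inE => /orP[/eqP ->|/NP GNb].
    by apply: Gmono GMa; apply: leq_maxl.
  by apply: Gmono GNb; apply: leq_maxr.
have [_ [a Ga]] := nextP (iter N next (exist _ x0 Px0)); apply.
have [|s sP ->] := Lgen a; first by exists N.+1.
rewrite big_seq; apply: (big_ind (G N)).
- exact: submodule0.
- by move=> u v Gu Gv; rewrite -[u]scale1r; apply: submoduleP.
- move=> u /sP[_ /NP Gu]; rewrite -[_ * _]addr0.
  by apply: (@submoduleP A A^o) => //; apply: submodule0.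
Qed.

(** * Products of ideals *)

Section IdealProducts.
Variable A : comNzRingType.
Implicit Types J K M : ideal A.

Lemma idealD J x y : J x -> J y -> J (x + y).
Proof. by move=> Jx Jy; rewrite -[x]scale1r; apply: submoduleP. Qed.

Lemma idealM J a x : J x -> J (a * x).
Proof.
move=> Jx; rewrite -[a * x]addr0.
by apply: (@submoduleP A A^o) => //; apply: submodule0.
Qed.

Lemma idealB J x y : J x -> J y -> J (x - y).
Proof. by move=> Jx Jy; apply: idealD => //; rewrite -mulN1r; apply: idealM. Qed.

Lemma ideal_sum J (I : Type) (s : seq I) (P : pred I) (F : I -> A) :
  (forall i, P i -> J (F i)) -> J (\sum_(i <- s | P i) F i).
Proof.
move=> JF; apply: (big_ind (submodule_set J)) => //; first exact: submodule0.
by move=> x y; apply: idealD.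
Qed.

Lemma ideal_ext J K : (forall x, J x <-> K x) -> J = K.
Proof.
case: J K => [J J0 JP] [K K0 KP] /= JK.
have JKE : J = K by apply/funext => x; apply/propext.
rewrite {}JKE in J0 JP *; congr Submodule; exact: Prop_irrelevance.
Qed.

Lemma mem_ideal_mul J K x y : J x -> K y -> ideal_mul J K (x * y).
Proof.
move=> Jx Ky; exists [:: (x, y)]; last by rewrite big_seq1.
by move=> u; rewrite inE => /eqP ->.
Qed.

Lemma ideal_mul_le J K M : (forall x y, J x -> K y -> M (x * y)) ->
  forall z, ideal_mul J K z -> M z.
Proof.
move=> JKM z [s sP ->]; rewrite big_seq; apply: ideal_sum => u /sP[].
exact: JKM.
Qed.

Lemma ideal_mulC : commutative (@ideal_mul A).
Proof.
move=> J K; apply: ideal_ext => z; split; apply: ideal_mul_le => x y ? ?;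
  by rewrite mulrC; apply: mem_ideal_mul.
Qed.

Definition colon J (y : A) : ideal A.
Proof.
exists (fun x => J (x * y)); first by rewrite mul0r; apply: submodule0.
by move=> a u v Ju Jv; rewrite mulrDl -mulrA; apply: idealD => //; apply: idealM.
Defined.

Lemma prime_colon_neq0 J x : prime_ideal (colon J x) -> x != 0.
Proof.
case=> p1 _; apply/eqP => x0; apply: p1; rewrite x0 /= mulr0.
exact: submodule0.
Qed.

Lemma ideal_mulA : associative (@ideal_mul A).
Proof.
have le J K M z : ideal_mul J (ideal_mul K M) z -> ideal_mul (ideal_mul J K) M z.
  apply: ideal_mul_le => x y Jx.
  suff : forall y, ideal_mul K M y -> colon (ideal_mul (ideal_mul J K) M) x y.
    by move=> H /H; rewrite mulrC.
  apply: ideal_mul_le => u v Ku Mv; rewrite /= mulrC mulrA.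
  by apply: mem_ideal_mul => //; apply: mem_ideal_mul.
move=> J K M; apply: ideal_ext => z; split; first exact: le.
rewrite ideal_mulC [ideal_mul J K]ideal_mulC => /le.
by rewrite ideal_mulC [ideal_mul M K]ideal_mulC.
Qed.

Lemma ideal_mul1 : left_id (ideal_one A) (@ideal_mul A).
Proof.
move=> J; apply: ideal_ext => z; split=> [|Jz]; last first.
  by rewrite -[z]mul1r; apply: mem_ideal_mul.
by apply: ideal_mul_le => x y _; apply: idealM.
Qed.

HB.instance Definition _ := Monoid.isComLaw.Build (ideal A) (ideal_one A)
  (@ideal_mul A) ideal_mulA ideal_mulC ideal_mul1.

Lemma ideal_expD J m n : ideal_exp J (m + n) = ideal_mul (ideal_exp J m) (ideal_exp J n).
Proof.
elim: m => [|m IHm]; first by rewrite ideal_mul1.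
by rewrite addSn /ideal_exp !iterS -/(ideal_exp _ _) IHm ideal_mulA.
Qed.

Section Power.
Variables (r : nat) (I : 'I_r -> ideal A).
Implicit Types m n : 'X_{1..r}.
Local Notation "I ^^ n" := (ideal_mexp I (fun_of_multinom n)) (at level 30).

Lemma mexp0 : I ^^ 0%MM = ideal_one A.
Proof. by rewrite /ideal_mexp big1 // => i _; rewrite mnm0E. Qed.

Lemma mexpD m n : I ^^ (m + n)%MM = ideal_mul (I ^^ m) (I ^^ n).
Proof.
rewrite /ideal_mexp -big_split /=; apply: eq_bigr => i _.
by rewrite mnmDE ideal_expD.
Qed.

Lemma mexp1 i : I ^^ U_(i)%MM = I i.
Proof.
rewrite /ideal_mexp (bigD1 i) //= mnm1E eqxx /= big1 => [|j ji].
  by rewrite !(ideal_mulC _ (ideal_one A)) !ideal_mul1.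
by rewrite mnm1E eq_sym (negPf ji).
Qed.

Lemma mem_mexpM m n x y : (I ^^ m) x -> (I ^^ n) y -> (I ^^ (m + n)%MM) (x * y).
Proof. by rewrite mexpD; apply: mem_ideal_mul. Qed.

Lemma mexp_le m n x : (m <= n)%MM -> (I ^^ n) x -> (I ^^ m) x.
Proof.
move=> /submK <-; rewrite mexpD; apply: ideal_mul_le => u v _; exact: idealM.
Qed.

(** Otherwise, a product of elements of the [I i] outside [p] would lie in
    [I ^^ m] but not in [p]. *)
Lemma mexp_prime m (p : ideal A) : prime_ideal p ->
  (forall x, (I ^^ m) x -> p x) ->
  exists2 i, (0 < m i)%N & forall x, I i x -> p x.
Proof.
move=> pp mp; apply: contrapT => no.
have pI i : (0 < m i)%N -> exists2 x, I i x & ~ p x.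
  by move=> mi; apply: contrapT => noi; apply: no; exists i => // x Ix;
     apply: contrapT => px; apply: noi; exists x.
have : exists2 x, (I ^^ m) x & ~ p x; last by case=> x /mp.
pose P J := exists2 x, submodule_set J x & ~ p x.
have P1 : P (ideal_one A) by exists 1 => //; case: pp.
have PM J K : P J -> P K -> P (ideal_mul J K).
  move=> [x Jx px] [y Ky py]; exists (x * y); first exact: mem_ideal_mul.
  by case: pp => _ pp /pp[].
apply: (big_ind P) => // i _; have: (m i <= m i)%N by [].
elim: {1 3}(m i) => [|k IHk] ki //; apply: PM; first by apply: pI; apply: leq_ltn_trans ki.
by apply: IHk; apply: ltnW.
Qed.

End Power.

End IdealProducts.

(** * Rees algebras *)

Lemma mnm_ind r (P : 'X_{1..r} -> Prop) :
  P 0%MM -> (forall i n, P n -> P (U_(i) + n)%MM) -> forall n, P n.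
Proof.
move=> P0 PS n; elim: {n}(mdeg n) {-2}n (erefl (mdeg n)) => [n /eqP|k IHk n nk].
  by rewrite mdeg_eq0 => /eqP ->.
have [i ni] : exists i, (0 < n i)%N.
  apply/existsP; apply: contraPT nk; rewrite negb_exists => /forallP n0.
  rewrite mdegE big1 // => i _; apply/eqP; by rewrite -leqn0 leqNgt n0.
have le_in : (U_(i) <= n)%MM.
  by apply/mnm_lepP => j; rewrite mnm1E; case: eqP => // <-.
rewrite -(submK le_in) addmC; apply: PS; apply: IHk.
by apply/eqP; rewrite -(eqn_add2r 1) -(mdeg1 i) -mdegD submK // nk mdeg1 addn1.
Qed.

Section ReesAlgebra.
Variables (A : comNzRingType) (r : nat) (I : 'I_r -> ideal A).
Hypothesis nA : noetherian_in (fun _ : A => True).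
Implicit Types m n : 'X_{1..r}.
Local Notation "I ^^ n" := (ideal_mexp I (fun_of_multinom n)) (at level 30).

(** The multigraded Rees algebra of [I], inside a polynomial ring over [A]. *)
Definition rees (Q : {mpoly A[r]}) : Prop := forall n, (I ^^ n) Q@_n.

Lemma rees_subring : subring rees.
Proof.
split=> [n|P Q RP RQ n|P Q RP RQ n].
- rewrite mcoeff1; have [->|_] := eqVneq; last exact: submodule0.
  by rewrite mexp0.
- by rewrite mcoeffB; apply: idealB.
- rewrite mcoeffM; apply: ideal_sum => k /eqP nE.
  by have := mem_mexpM (RP k.1) (RQ k.2); rewrite -nE.
Qed.

Lemma rees_monomial n x : (I ^^ n) x -> rees (x *: 'X_[n]).
Proof.
move=> Ix m; rewrite mcoeffZ mcoeffX; have [<-|_] := eqVneq.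
  by rewrite mulr1.
by rewrite mulr0; apply: submodule0.
Qed.

(** It is generated over [A] by finitely many elements of degree one. *)
Lemma rees_noetherian : noetherian_in rees.
Proof.
have /choice[L LP] : forall i, exists L : seq A, (forall g, g \in L -> I i g) /\
    forall x, I i x -> lincomb (fun=> True) (fun g => g \in L) x.
  by move=> i; have [L] := nA (fun x (_ : I i x) => Logic.I); exists L.
pose S (Q : {mpoly A[r]}) := exists2 x : A, True & Q = x%:MP.
have nS : noetherian_in S by apply: noetherian_in_image nA.
have rS : subring S.
  split; first by exists 1.
    by move=> _ _ [x _ ->] [y _ ->]; exists (x - y); rewrite ?rmorphB.
  by move=> _ _ [x _ ->] [y _ ->]; exists (x * y); rewrite ?rmorphM.
have [S' [rS' nS' SS' LS' minS']] := noetherian_adjoin_seq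
  (flatten [seq [seq g *: 'X_i | g <- L i] | i <- enum 'I_r]) rS nS.
have S'Z a Q : S' Q -> S' (a *: Q).
  move=> S'Q; rewrite -mul_mpolyC; have [_ _ S'M] := rS'.
  by apply: (S'M) => //; apply: SS'; exists a.
(* the ideal of the coefficients allowed in degree [n] by the generated algebra *)
pose E n : ideal A := @Submodule A A^o (fun x => S' (x *: 'X_[n]))
  (eq_ind_r S' (subring0 rS') (scale0r _))
  (fun a u v Su Sv => eq_ind_r S' (subringD rS' (S'Z a _ Su) Sv)
     (eq_trans (scalerDl _ _ _) (congr1 (+%R^~ _) (esym (scalerA _ _ _))))).
have IE n : forall x, (I ^^ n) x -> E n x.
  elim/mnm_ind: n => [|i n IHn] x.
    by move=> _ /=; rewrite mpolyX0; apply: (S'Z); have [] := rS'.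
  rewrite mexpD mexp1; apply: ideal_mul_le => a b Ia /IHn /= Eb.
  have -> : (a * b) *: 'X_[U_(i) + n] = (a *: 'X_i) * (b *: 'X_[n]) :> {mpoly A[r]}.
    by rewrite mpolyXD -scalerAl -scalerAr scalerA.
  have [_ _ S'M] := rS'; apply: S'M => //.
  have [LI /(_ _ Ia)[s sP ->]] := LP i.
  rewrite scaler_suml; apply: subring_sum => // u /sP[_ uL].
  rewrite -scalerA; apply: (S'Z); apply: LS'; apply/flattenP.
  exists [seq g *: 'X_i | g <- L i]; last exact: map_f.
  by apply/mapP; exists i; rewrite ?mem_enum.
have S'R Q : S' Q -> rees Q.
  apply: minS'; [exact: rees_subring|move=> _ [x _ ->]|].
    by rewrite -[x%:MP]mulr1 mul_mpolyC -mpolyX0; apply: rees_monomial; rewrite mexp0.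
  move=> _ /flattenP[_ /mapP[i _ ->]] /mapP[g gL ->].
  by apply: rees_monomial; rewrite mexp1; case: (LP i) => + _; apply.
have RS' Q : rees Q -> S' Q.
  move=> RQ; rewrite [Q]mpolyE; apply: subring_sum => // n _.
  exact: (IE n _ (RQ n)).
move=> B BR; have [|K KB KP] := nS' B; first by move=> Q /BR/RS'.
exists K => // Q /KP[s sP ->]; exists s => // u /sP[/S'R].
by [].
Qed.

Lemma mcoeffMXn (Q : {mpoly A[r]}) x m n :
  (Q * (x *: 'X_[m]))@_n = if (m <= n)%MM then Q@_(n - m)%MM * x else 0.
Proof.
rewrite -scalerAr mcoeffZ mulrC; case: ifPn => [/submK nE|mn].
  by rewrite -{1}nE addmC mcoeffMX.
rewrite mcoeffM big1 ?mul0r // => k /eqP nE; rewrite mcoeffX.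
have [mk|_] := eqVneq; last by rewrite mulr0.
by case/negP: mn; rewrite nE mk lem_addl.
Qed.

(** The member [x] of [I ^^ n] stands for the monomial [x *: 'X_[n]] of the Rees
    algebra; the coefficient of ['X_[n]] in a combination of such monomials
    only involves the generators of degree at most [n]. *)
Lemma rees_finite_basis (B : 'X_{1..r} -> A -> Prop) :
  (forall n x, B n x -> (I ^^ n) x) ->
  exists2 L : seq ('X_{1..r} * A), (forall u, u \in L -> B u.1 u.2) &
    forall n x, B n x -> exists2 s : seq (A * ('X_{1..r} * A)),
      (forall w, w \in s ->
         [/\ w.2 \in L, (w.2.1 <= n)%MM & (I ^^ (n - w.2.1)%MM) w.1]) &
      x = \sum_(w <- s) w.1 * w.2.2.
Proof.
move=> BI; pose B' Q := exists u, B u.1 u.2 /\ Q = u.2 *: 'X_[u.1] :> {mpoly A[r]}.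
have [|L' L'B L'P] := rees_noetherian (B := B').
  by move=> _ [u [/BI Iu ->]]; apply: rees_monomial.
have /choice[pick pickP] : forall Q, exists u : 'X_{1..r} * A,
    Q \in L' -> B u.1 u.2 /\ Q = u.2 *: 'X_[u.1].
  move=> Q; have [/L'B[u uP]|_] := boolP (Q \in L'); first by exists u.
  by exists (0%MM, 0).
exists [seq pick Q | Q <- L'] => [_ /mapP[Q /pickP[BQ _] ->] //|n x Bx].
have [|s sP xE] := L'P (x *: 'X_[n]); first by exists (n, x).
exists [seq (u.1@_(n - (pick u.2).1)%MM, pick u.2) | u <- s & ((pick u.2).1 <= n)%MM].
  move=> w /mapP[u]; rewrite mem_filter => /andP[le_un /sP[Ru uL]] -> /=.
  by split=> //; exact: map_f.
have : (x *: 'X_[n] : {mpoly A[r]})@_n = x by rewrite mcoeffZ mcoeffX eqxx mulr1.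
rewrite xE raddf_sum big_map big_filter /= => <-.
rewrite big_seq [RHS]big_mkcond /= [RHS]big_seq; apply: eq_bigr => u /sP[_ uL].
by have [_ {1}->] := pickP _ uL; rewrite mcoeffMXn.
Qed.

End ReesAlgebra.

(** * Ratliff's theorem *)

Section Ratliff.
Variables (A : idomainType) (r : nat) (I : 'I_r -> ideal A).
Hypothesis nA : noetherian_in (fun _ : A => True).
Implicit Types k l m n : 'X_{1..r}.
Local Notation "I ^^ n" := (ideal_mexp I (fun_of_multinom n)) (at level 30).

Lemma lem_bound (T : eqType) (L : seq ('X_{1..r} * T)) :
  exists k, forall u, u \in L -> (u.1 <= k)%MM.
Proof.
elim: L => [|u L [k kP]]; first by exists 0%MM.
exists (u.1 + k)%MM => v; rewrite inE => /orP[/eqP ->|/kP vk]; first exact: lem_addr.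
by apply: lepm_trans vk _; apply: lem_addl.
Qed.

(** An Artin-Rees bound: the elements of [I ^^ n] divisible by [a] are
    combinations of finitely many such elements [a * z], of bounded degree. *)
Lemma mexp_cancel (a : A) : a != 0 ->
  exists k, forall n z, (I ^^ n) (a * z) -> (I ^^ (n - k)%MM) z.
Proof.
move=> a0; pose B n y := (I ^^ n) y /\ exists z, y = a * z.
have [|L LB LP] := rees_finite_basis nA (I := I) (B := B); first by move=> n y [].
have [k kP] := lem_bound L; exists k => n z Iaz.
have [|s sP azE] := LP n (a * z); first by split=> //; exists z.
have /choice[q qP] : forall w : A * ('X_{1..r} * A), exists z, w \in s -> w.2.2 = a * z.
  move=> w; have [/sP[/LB[_ [y ->]] _ _]|_] := boolP (w \in s); first by exists y.
  by exists 0.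
have -> : z = \sum_(w <- s) w.1 * q w.
  apply: (mulfI a0); rewrite azE mulr_sumr; apply: eq_big_seq => w /qP ->.
  by rewrite mulrCA.
rewrite big_seq; apply: ideal_sum => w /sP[/kP wk _ Iw]; rewrite mulrC.
apply: idealM; apply: mexp_le Iw; apply/mnm_lepP => i; rewrite !mnmBE.
by apply: leq_sub2l; move/mnm_lepP: wk.
Qed.

(** Splitting a factor in [I i] off [y] makes the hypothesis on [I i * x] bear on
    [y * x]. *)
Lemma mexp_mul_le i k l x y : (U_(i) <= k)%MM -> (I ^^ k) y ->
  (forall b, I i b -> (I ^^ (U_(i) + l)%MM) (b * x)) -> (I ^^ (k + l)%MM) (y * x).
Proof.
move=> /submK <-; rewrite addmC mexpD mexp1 => Iy Ibx; move: y Iy.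
suff H : forall y, ideal_mul (I i) (I ^^ (k - U_(i))%MM) y ->
    colon (I ^^ (U_(i) + (k - U_(i)) + l)%MM) x y by [].
apply: ideal_mul_le => b c Ib Ic /=; rewrite mulrAC -addmA [(_ - _ + _)%MM]addmC addmA.
exact: mem_mexpM (Ibx _ Ib) Ic.
Qed.

(** Ratliff's theorem. By [mexp_cancel], [(I ^^ (U_(i) + n) : I i)] lies in
    [I ^^ (n - k)]; so these colons form a module of finite type over the Rees
    algebra, and beyond the degrees of its generators the colon for [n] is
    generated by multiples by [I i] of the previous colons. *)
Lemma ratliff i : (exists2 a, I i a & a != 0) ->
  exists k, forall n x, (k <= n)%MM ->
    (forall b, I i b -> (I ^^ (U_(i) + n)%MM) (b * x)) -> (I ^^ n) x.
Proof.
move=> [a Ia a0]; have [k kP] := mexp_cancel a0.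
pose B m x := (I ^^ m) x /\ forall b, I i b -> (I ^^ (U_(i) + (k + m))%MM) (b * x).
have [|L LB LP] := rees_finite_basis nA (I := I) (B := B); first by move=> n y [].
have [l lP] := lem_bound L; exists (U_(i) + l + k)%MM => n x le_n Ix.
have kn : (k <= n)%MM by apply: lepm_trans le_n; apply: lem_addl.
have ln : (U_(i) + l <= n - k)%MM.
  apply/mnm_lepP => j; move/mnm_lepP/(_ j): le_n.
  by rewrite !(mnmDE, mnmBE); lia.
have [|s sP ->] := LP (n - k)%MM x.
  split.
    have := kP _ _ (Ix _ Ia); apply: mexp_le; apply/mnm_lepP => j.
    by rewrite !(mnmDE, mnmBE) leq_sub2r // leq_addl.
  by rewrite [(k + _)%MM]addmC submK.
rewrite big_seq; apply: ideal_sum => w /sP[wL wn Iw].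
have [_ Iw2] := LB _ wL.
have nE : (n - k - w.2.1 + (k + w.2.1) = n)%MM.
  by rewrite [(k + _)%MM]addmC addmA !submK.
rewrite -nE; apply: (mexp_mul_le (i := i)) Iw _ => //.
apply/mnm_lepP => j; move/mnm_lepP/(_ j): ln; move/mnm_lepP/(_ j): (lP _ wL).
rewrite !(mnmDE, mnmBE); lia.
Qed.

End Ratliff.

(** * Homogeneous ideals *)

Section Homogeneous.
Variables (R0 : idomainType) (d : nat) (f : 'I_d -> nat).
Local Notation R := {mpoly R0[d]}.
Local Notation hpart := (pihomog (wdeg f)).
Local Notation whomog k p := (p \is k.-homog for (wdeg f)).
Implicit Types (p q x y : R) (J K : ideal R).

Lemma hpart_homogM i k p q : whomog i p ->
  hpart k (p * q) = if (i <= k)%N then p * hpart (k - i) q else 0.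
Proof.
move=> hp.
have [N sq] : exists N, (mmeasure (wdeg f) q <= N)%N by exists (mmeasure (wdeg f) q).
rewrite {1}(pihomog_partitionE sq) mulr_sumr raddf_sum /=.
have hE (j : 'I_N) : hpart k (p * hpart j q) = if i + j == k then p * hpart j q else 0.
  have hpq : whomog (i + j) (p * hpart j q) by apply: dhomogM => //; apply: pihomogP.
  by case: eqP => [<-|/eqP ne]; [apply: pihomog_dE|apply: pihomog_ne0 hpq].
rewrite (eq_bigr _ (fun j _ => hE j)) -big_mkcond /=.
case: leqP => ik; last first.
  by rewrite big_pred0 // => j; apply/eqP => jk; move: ik; rewrite -jk ltnNge leq_addr.
have [lt_kN|le_Nk] := ltnP (k - i) N.
  rewrite (big_pred1 (Ordinal lt_kN)) // => j /=.
  by rewrite -val_eqE /= -(eqn_add2l i) [(i + (k - i))%N]addnC subnK.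
rewrite big_pred0 => [|j]; last first.
  by apply/eqP => jk; move: le_Nk; rewrite -jk addKn leqNgt ltn_ord.
rewrite pihomogE big1_seq ?mulr0 // => m /andP[/eqP mk mq].
move: le_Nk; rewrite -mk leqNgt => /negP[].
exact: leq_trans (mmeasure_mnm_lt _ mq) sq.
Qed.

Lemma hpartM k p q :
  hpart k (p * q) = \sum_(i < k.+1) hpart i p * hpart (k - i) q.
Proof.
have [N sp] : exists N, (mmeasure (wdeg f) p <= N)%N by exists (mmeasure (wdeg f) p).
have sp' : (mmeasure (wdeg f) p <= k.+1 + N)%N by apply: leq_trans sp (leq_addl _ _).
rewrite {1}(pihomog_partitionE sp') mulr_suml raddf_sum /=.
rewrite [RHS](big_ord_widen_cond (k.+1 + N) xpredT
  (fun i => hpart i p * hpart (k - i) q)) ?leq_addr // [RHS]big_mkcond /=.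
by apply: eq_bigr => i _; rewrite (hpart_homogM k q (pihomogP _ i p)).
Qed.

Lemma hpart_eq0 p : (forall k, hpart k p = 0) -> p = 0.
Proof. by move=> h; rewrite (pihomog_partitionE (leqnn (mmeasure (wdeg f) p))) big1. Qed.

Lemma hpart_sum k (I : Type) (s : seq I) (P : pred I) (F : I -> R) :
  hpart k (\sum_(i <- s | P i) F i) = \sum_(i <- s | P i) hpart k (F i).
Proof. exact: raddf_sum. Qed.

Lemma homogeneous_ideal_mul J K :
  homogeneous_ideal f J -> homogeneous_ideal f K ->
  homogeneous_ideal f (ideal_mul J K).
Proof.
move=> hJ hK p k [s sP ->]; rewrite hpart_sum big_seq.
apply: ideal_sum => u /sP[Ju Ku]; rewrite hpartM.
by apply: ideal_sum => i _; apply: mem_ideal_mul; [apply: hJ|apply: hK].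
Qed.

(** The polynomials of order at least [k]: all weights being nonnegative,
    they form an ideal. *)
Definition initial_ideal (k : nat) : ideal R.
Proof.
refine (@Submodule R R^o (fun p => forall i, (i < k)%N -> hpart i p = 0) _ _).
  by move=> i _; rewrite pihomog0.
move=> a p q hp hq i ik; rewrite pihomogD hq // addr0 hpartM big1 // => j _.
by rewrite hp ?mulr0 // (leq_ltn_trans _ ik) // leq_subr.
Defined.

Lemma initial_idealM i j p q : initial_ideal i p -> initial_ideal j q ->
  hpart (i + j) (p * q) = hpart i p * hpart j q.
Proof.
move=> hp hq; have lt_i : (i < (i + j).+1)%N by rewrite ltnS leq_addr.
rewrite hpartM (bigD1 (Ordinal lt_i)) //= addKn big1 ?addr0 // => l.
rewrite -val_eqE /= neq_ltn => /orP[li|il]; first by rewrite hp ?mul0r.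
rewrite [X in _ * X]hq ?mulr0 //; have := ltn_ord l; move: il; lia.
Qed.

Lemma initial_ideal_mul i j p :
  ideal_mul (initial_ideal i) (initial_ideal j) p -> initial_ideal (i + j) p.
Proof.
move: p; apply: ideal_mul_le => p q hp hq k kij; rewrite hpartM big1 // => l _.
have [li|il] := ltnP l i; first by rewrite hp ?mul0r.
rewrite [X in _ * X]hq ?mulr0 //; move: kij (ltn_ord l) il; lia.
Qed.

Lemma homog_initial_le k l x : x != 0 -> whomog k x -> initial_ideal l x -> (l <= k)%N.
Proof.
move=> x0 hx ix; rewrite leqNgt; apply/negP => /ix.
by rewrite pihomog_dE // => /eqP; rewrite (negPf x0).
Qed.

(** It suffices to test the primality of a homogeneous ideal with one
    homogeneous factor: compare the lowest components outside the ideal. *)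
Lemma homogeneous_prime J : homogeneous_ideal f J -> ~ J 1 ->
  (forall k a b, whomog k b -> J (a * b) -> J a \/ J b) -> prime_ideal J.
Proof.
move=> hJ J1 JM; split=> // a b Jab; apply: contrapT => /not_orP[Ja Jb].
have low p : ~ J p -> exists i, ~ J (hpart i p) /\ forall j, (j < i)%N -> J (hpart j p).
  move=> Jp; have ex : exists i, `[< ~ J (hpart i p) >].
    apply: contrapT => no; apply: Jp.
    rewrite (pihomog_partitionE (leqnn (mmeasure (wdeg f) p))); apply: ideal_sum => i _.
    by apply: contrapT => Ji; apply: no; exists i; apply/asboolP.
  case: (ex_minnP ex) => i /asboolP Ji imin; exists i; split=> // j ji.
  by apply: contrapT => /asboolP/imin; rewrite leqNgt ji.
have [s [Jas lts]] := low _ Ja; have [t [Jbt ltt]] := low _ Jb.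
suff Jst : J (hpart s a * hpart t b) by case: (JM t _ _ (pihomogP _ t b) Jst).
have lt_s : (s < (s + t).+1)%N by rewrite ltnS leq_addr.
have := hJ _ (s + t)%N Jab; rewrite hpartM (bigD1 (Ordinal lt_s)) //= addKn.
set S := (X in _ + X) => Jst.
rewrite -[_ * _](addrK S); apply: idealB => //; rewrite /S {S Jst}.
apply: ideal_sum => i; rewrite -val_eqE /= neq_ltn => /orP[li|il].
  by rewrite mulrC; apply: idealM; apply: lts.
apply: idealM; apply: ltt; move: il (ltn_ord i); lia.
Qed.

End Homogeneous.

Arguments initial_ideal {R0 d} f k.

(** * Persistence and boundedness of prime annihilators *)

Section AsymptoticPrimes.
Variables (R0 : idomainType) (d : nat) (f : 'I_d -> nat) (r : nat).
Local Notation R := {mpoly R0[d]}.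
Variable I : 'I_r -> ideal R.
Variable e : 'I_r -> nat.
Local Notation hpart := (pihomog (wdeg f)).
Local Notation whomog k p := (p \is k.-homog for (wdeg f)).
Local Notation "I ^^ n" := (ideal_mexp I (fun_of_multinom n)) (at level 30).
Implicit Types (m n : 'X_{1..r}) (x y : R) (j : 'I_r).

Hypothesis nR : noetherian_in (fun _ : R => True).
Hypothesis I_homog : forall i, homogeneous_ideal f (I i).
Hypothesis I_initial : forall i x, I i x -> initial_ideal f (e i) x.

(** The degree of the product of elements of degree [e i] of the [I i]. *)
Definition least_degree n : nat := (\sum_(i < r) e i * n i)%N.

Lemma least_degree0 : least_degree 0%MM = 0%N.
Proof. by rewrite /least_degree big1 // => i _; rewrite mnm0E muln0. Qed.

Lemma least_degreeD m n : least_degree (m + n)%MM = (least_degree m + least_degree n)%N.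
Proof.
by rewrite /least_degree -big_split /=; apply: eq_bigr => i _; rewrite mnmDE mulnDr.
Qed.

Lemma least_degree1 i : least_degree U_(i)%MM = e i.
Proof.
rewrite /least_degree (bigD1 i) //= mnm1E eqxx muln1 big1 ?addn0 // => j ji.
by rewrite mnm1E eq_sym (negPf ji) muln0.
Qed.

Lemma mexp_homog n : homogeneous_ideal f (I ^^ n).
Proof.
elim/mnm_ind: n => [|i n IHn]; first by rewrite mexp0.
by rewrite mexpD mexp1; apply: homogeneous_ideal_mul.
Qed.

Lemma mexp_initial n x : (I ^^ n) x -> initial_ideal f (least_degree n) x.
Proof.
elim/mnm_ind: n x => [|i n IHn] x; first by rewrite least_degree0.
rewrite mexpD mexp1 least_degreeD least_degree1 => Ix; apply: initial_ideal_mul; move: x Ix.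
by apply: ideal_mul_le => a b /I_initial Ia /IHn Ib; apply: mem_ideal_mul.
Qed.

(** In a sum of products of elements of [I i] and [I ^^ n], only the products
    of the components of least degrees contribute to the least degree. *)
Lemma mexp_initial_split i n x (J : ideal R) :
  (I ^^ (U_(i) + n)%MM) x -> whomog (least_degree (U_(i) + n)%MM) x ->
  (forall a b, I i a -> whomog (e i) a -> (I ^^ n) b -> J (a * b)) -> J x.
Proof.
rewrite mexpD mexp1 least_degreeD least_degree1 => -[s sP xE] /pihomog_dE <- IJ.
rewrite xE hpart_sum big_seq; apply: ideal_sum => w /sP[Iw1 Iw2].
rewrite (initial_idealM (I_initial Iw1) (mexp_initial Iw2)); apply: IJ.
- exact: I_homog.
- exact: pihomogP.
- exact: mexp_homog.
Qed.

(** On the elements whose degree exceeds the least possible one by [delta],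
    coefficients of least possible degree suffice in [rees_finite_basis]. *)
Lemma rees_finite_basis_homog delta (B : 'X_{1..r} -> R -> Prop) :
  (forall n x, B n x -> (I ^^ n) x /\ whomog (least_degree n + delta) x) ->
  exists2 L : seq ('X_{1..r} * R), (forall u, u \in L -> B u.1 u.2) &
    forall n x, B n x -> exists2 s : seq (R * ('X_{1..r} * R)),
      (forall w, w \in s ->
         [/\ w.2 \in L, (w.2.1 <= n)%MM, (I ^^ (n - w.2.1)%MM) w.1 &
             whomog (least_degree (n - w.2.1)%MM) w.1]) &
      x = \sum_(w <- s) w.1 * w.2.2.
Proof.
move=> BI; have [|L LB LP] := rees_finite_basis nR (I := I) (B := B).
  by move=> n x /BI[].
exists L => // n x Bx; have [s sP xE] := LP n x Bx.
exists [seq (hpart (least_degree (n - w.2.1)%MM) w.1, w.2) | w <- s].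
  move=> v /mapP[w /sP[wL wn Iw] ->] /=; split=> //.
    exact: mexp_homog.
  exact: pihomogP.
have [_ /pihomog_dE <-] := BI _ _ Bx.
rewrite xE hpart_sum big_map; apply: eq_big_seq => w /sP[wL wn Iw] /=.
have [_ hw] := BI _ _ (LB _ wL).
have nE : least_degree n = (least_degree (n - w.2.1)%MM + least_degree w.2.1)%N.
  by rewrite -least_degreeD submK.
by rewrite mulrC (hpart_homogM _ _ hw) nE -addnA leq_addl addnK mulrC.
Qed.

Section Bad.
Variables (u : 'X_{1..r}) (j : 'I_r) (delta : nat).

(** The annihilator of the class of [x] in [I ^^ n / I ^^ (n + u)]. *)
Definition ann n x : ideal R := colon (I ^^ (n + u)%MM) x.

(** The element [x] bounds the [v]-number of [I ^^ n / I ^^ (n + u)], by an excess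
    [delta] over the least possible degree. *)
Definition prime_witness n x :=
  [/\ (I ^^ n) x, whomog (least_degree n + delta) x & prime_ideal (ann n x)].

(** The annihilator of [a * x] always contains that of [x]: for a bad [x] it is
    strictly larger, whichever [a] of least degree is taken in [I j]. *)
Definition bad n x := prime_witness n x /\
  forall a, I j a -> whomog (e j) a ->
    ~ forall c, ann (U_(j) + n)%MM (a * x) c -> ann n x c.

(** A common annihilator is the product of one for each member of a finite
    generating set of the ideal of these [a]; it avoids the prime [ann n x]. *)
Lemma bad_kill n x : bad n x -> exists c, ~ ann n x c /\
  forall a, I j a -> whomog (e j) a -> ann (U_(j) + n)%MM (a * x) c.
Proof.
move=> [[_ _ [p1 pM]] bx].
have [L LB LP] := nR (fun a (_ : I j a /\ whomog (e j) a) => Logic.I).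
have [c cp cL] : exists2 c, ~ ann n x c &
    forall a, a \in L -> ann (U_(j) + n)%MM (a * x) c.
  elim: L LB {LP} => [|a L IHL] LB; first by exists 1.
  have [|c cp cL] := IHL; first by move=> b bL; apply: LB; rewrite inE bL orbT.
  have [Ia ha] := LB a (mem_head a L).
  have /existsNP[b /not_implyP[ab bp]] := bx a Ia ha.
  exists (b * c) => [/pM[]//|y].
  rewrite inE => /orP[/eqP ->|/cL yc]; last exact: idealM.
  by rewrite [b * c]mulrC; apply: idealM.
exists c; split=> // a Ia ha.
have /LP[s sP ->] : I j a /\ whomog (e j) a by [].
rewrite /= mulr_suml mulr_sumr big_seq; apply: ideal_sum => w /sP[_ /cL] /=.
by move=> cw; rewrite -mulrA mulrCA; apply: idealM.
Qed.

(** Write [x] as a sum of [f_l * x_l], the [x_l] being finitely many generators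
    of [B]. Each term is killed by [ann x_l] and, when [n j] is so large that
    [f_l] has a factor in [I j], by the element of [bad_kill] for [x_l], which
    lies outside [ann x_l]. If every term were killed by an element outside
    the prime [ann x], the product of these elements would kill [x]; so [ann x]
    contains all that was said to kill some term. *)
Lemma bad_step (B : 'X_{1..r} -> R -> Prop) : (forall n x, B n x -> bad n x) ->
  exists2 L : seq ('X_{1..r} * R), (forall v, v \in L -> B v.1 v.2) &
    exists N, forall n x, B n x -> (N <= n j)%N -> exists2 v, v \in L &
      (forall c, ann v.1 v.2 c -> ann n x c) /\
      exists2 c, ann n x c & ~ ann v.1 v.2 c.
Proof.
move=> Bbad; have [|L LB LP] := rees_finite_basis_homog (delta := delta) (B := B).
  by move=> n x /Bbad[[]].
have [k kP] := lem_bound L.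
exists L => //; exists (k j).+1 => n x Bx nj.
have [[_ _ [p1 pM]] _] := Bbad _ _ Bx.
have [s sP xE] := LP _ _ Bx.
apply: contrapT => no.
suff [c cp cs] : exists2 c, ~ ann n x c & forall w, w \in s ->
    (I ^^ (n + u)%MM) (c * (w.1 * w.2.2)).
  apply: cp; rewrite /= xE mulr_sumr big_seq.
  exact: ideal_sum.
elim: s sP {xE} => [|w s IHs] sP; first by exists 1.
have [|c cp cs] := IHs; first by move=> v vs; apply: sP; rewrite inE vs orbT.
have [wL wn Iw hw] := sP w (mem_head w s).
have [b [bw bP]] := bad_kill (Bbad _ _ (LB _ wL)).
have nE : (n + u = n - w.2.1 + (w.2.1 + u))%MM by rewrite addmA submK.
have killp a : ann w.2.1 w.2.2 a -> (I ^^ (n + u)%MM) (a * (w.1 * w.2.2)).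
  by move=> aw; rewrite mulrCA nE; apply: mem_mexpM.
have killb : (I ^^ (n + u)%MM) (b * (w.1 * w.2.2)).
  have jn : (U_(j) <= n - w.2.1)%MM.
    apply/mnm_lepP => i; rewrite mnm1E mnmBE; case: eqP => // <-.
    by move/mnm_lepP/(_ j): (kP _ wL) => wk; rewrite subn_gt0 (leq_ltn_trans wk).
  suff: colon (I ^^ (n + u)%MM) (b * w.2.2) w.1 by rewrite /= mulrCA.
  move: Iw hw; rewrite -(submK jn) addmC => Iw hw.
  apply: (mexp_initial_split Iw hw) => a y Ia ha Iy /=.
  rewrite -mulrA [_ * (y * _)]mulrCA [a * _]mulrCA.
  suff -> : (n + u = n - w.2.1 - U_(j) + (U_(j) + w.2.1 + u))%MM.
    exact: mem_mexpM (bP a Ia ha).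
  by rewrite -addmA addmA submK.
have [b' b'p b'w] : exists2 b', ~ ann n x b' & (I ^^ (n + u)%MM) (b' * (w.1 * w.2.2)).
  have [bp|/existsNP[a /not_implyP[aw ap]]] :=
    pselect (forall a, ann w.2.1 w.2.2 a -> ann n x a); last first.
    by exists a => //; apply: killp.
  exists b => // pb; apply: no; exists w.2 => //; split=> //; by exists b.
exists (b' * c) => [/pM[]//|v].
rewrite inE => /orP[/eqP ->|/cs vc].
  by rewrite [b' * c]mulrC -mulrA; apply: idealM.
by rewrite -mulrA; apply: idealM.
Qed.

End Bad.

End AsymptoticPrimes.

Lemma seq_bound (T : eqType) (L : seq T) (Q : T -> nat -> Prop) :
  (forall v, v \in L -> exists N, Q v N) ->
  (forall v M N, (M <= N)%N -> Q v M -> Q v N) ->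
  exists N, forall v, v \in L -> Q v N.
Proof.
move=> LQ Qmono; elim: L LQ => [|v L IHL] LQ; first by exists 0%N.
have [|N NP] := IHL; first by move=> w wL; apply: LQ; rewrite inE wL orbT.
have [M MP] := LQ v (mem_head v L); exists (maxn M N) => w.
rewrite inE => /orP[/eqP ->|/NP]; first by apply: Qmono MP; apply: leq_maxl.
by apply: Qmono; apply: leq_maxr.
Qed.

Section Stabilisation.
Variables (R0 : idomainType) (d : nat) (f : 'I_d -> nat) (r : nat).
Local Notation R := {mpoly R0[d]}.
Variable I : 'I_r -> ideal R.
Variable e : 'I_r -> nat.
Local Notation whomog k p := (p \is k.-homog for (wdeg f)).
Local Notation "I ^^ n" := (ideal_mexp I (fun_of_multinom n)) (at level 30).
Implicit Types (m n : 'X_{1..r}) (x y : R) (j : 'I_r).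

Hypothesis nR : noetherian_in (fun _ : R => True).
Hypothesis I_homog : forall i, homogeneous_ideal f (I i).
Hypothesis I_initial : forall i x, I i x -> initial_ideal f (e i) x.

Local Notation least_degree := (least_degree e).

(** By noetherian induction on [q], bad elements whose prime strictly contains
    [q] have bounded degree: [bad_step] finds below such a prime, once the
    degree is large, one of finitely many primes strictly containing [q]. *)
Lemma bad_bounded u j delta :
  exists N, forall n x, bad f I e u j delta n x -> (n j < N)%N.
Proof.
pose above (q : ideal R) n x := (forall c, q c -> ann I u n x c) /\
  exists2 c, ann I u n x c & ~ q c.
pose bounded (q : ideal R) N := forall n x,
  bad f I e u j delta n x -> above q n x -> (n j < N)%N.
have bounded_mono q M N : (M <= N)%N -> bounded q M -> bounded q N.
  by move=> MN bM n x bx qx; apply: leq_trans MN; apply: bM qx.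
have bounded_all q : exists N, bounded q N.
  apply: contrapT; move: q; apply/forallNP => -[q0 q0N].
  have [|q qN qmax] := noetherian_max (@id (ideal R))
    (P := fun q => ~ exists N, bounded q N) nR; first by exists q0.
  apply: qN; have [|L LB [N NP]] := bad_step nR I_homog I_initial (u := u) (j := j)
    (delta := delta)
    (B := fun n x => bad f I e u j delta n x /\ above q n x); first by move=> n x [].
  have [||M MP] := @seq_bound _ L (fun v M => bounded (ann I u v.1 v.2) M).
  - move=> v /LB[_ [qv [c vc qc]]]; apply: contrapT => vN.
    by apply: qc; apply: qmax vc.
  - by move=> v M1 M2; apply: bounded_mono.
  exists (maxn M N) => n x bx qx; rewrite leq_max; case: ltnP => //= Mn.
  rewrite ltnNge; apply/negP => Nn.
  have [//|v vL vx] := NP n x _ Nn.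
  by have := MP _ vL n x bx vx; rewrite ltnNge Mn.
(* the same step, without a lower bound on the primes *)
have [|L LB [N NP]] := bad_step nR I_homog I_initial (u := u) (j := j)
    (delta := delta) (B := bad f I e u j delta).
  by [].
have [|v M M'|M MP] := @seq_bound _ L (fun v M => bounded (ann I u v.1 v.2) M).
- by move=> v _; apply: bounded_all.
- exact: bounded_mono.
exists (maxn M N) => n x bx; rewrite leq_max; case: ltnP => //= Mn.
rewrite ltnNge; apply/negP => Nn.
have [v vL vx] := NP n x bx Nn.
by have := MP _ vL n x bx vx; rewrite ltnNge Mn.
Qed.

(** Finitely many directions and excesses are concerned, so that beyond some
    degree no witness is bad; then some [a * x] is a witness. *)
Lemma prime_witness_persists u c : exists N, forall n,
  (forall i, (N <= n i)%N) -> forall j delta x, (delta <= c)%N ->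
  prime_witness f I e u delta n x ->
  exists y, prime_witness f I e u delta (U_(j) + n)%MM y.
Proof.
pose Q (v : 'I_r * 'I_c.+1) N := forall n x,
  bad f I e u v.1 v.2 n x -> (n v.1 < N)%N.
have [|v M N MN QM n x|N NP] := @seq_bound _ (enum {: 'I_r * 'I_c.+1}) Q.
- by move=> v _; apply: bad_bounded.
- by move/QM => nM; apply: leq_trans MN.
exists N => n nN j delta x dc wx.
have {NP} NP := NP (j, Ordinal (dc : (delta < c.+1)%N)) (mem_enum _ _) n x.
have : ~ bad f I e u j delta n x by move/NP; rewrite ltnNge nN.
move=> nbad; apply: contrapT => noy; apply: nbad; split=> // a Ia ha sub.
have [Ix hx px] := wx.
apply: noy; exists (a * x); split.
- by rewrite mexpD mexp1; apply: mem_ideal_mul.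
- by rewrite least_degreeD least_degree1 -addnA; apply: dhomogM.
- suff -> : ann I u (U_(j) + n)%MM (a * x) = ann I u n x by [].
  apply: ideal_ext => b; split; first exact: sub.
  by move=> bx; rewrite /= mulrCA -addmA mexpD mexp1; apply: mem_ideal_mul.
Qed.

Variable a : 'I_r -> R.
Hypothesis a_in : forall i, I i (a i).
Hypothesis a_homog : forall i, whomog (e i) (a i).
Hypothesis a_neq0 : forall i, a i != 0.

Definition apow n : R := \prod_(i < r) a i ^+ n i.

Lemma apowD m n : apow (m + n)%MM = apow m * apow n.
Proof.
by rewrite /apow -big_split /=; apply: eq_bigr => i _; rewrite mnmDE exprD.
Qed.

Lemma apow1 i : apow U_(i)%MM = a i.
Proof.
rewrite /apow (bigD1 i) //= mnm1E eqxx big1 ?mulr1 // => j ji.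
by rewrite mnm1E eq_sym (negPf ji).
Qed.

Lemma apow0 : apow 0%MM = 1.
Proof. by rewrite /apow big1 // => i _; rewrite mnm0E. Qed.

Lemma mem_apow n : (I ^^ n) (apow n).
Proof.
elim/mnm_ind: n => [|i n IHn]; first by rewrite mexp0.
by rewrite apowD mexpD mexp1 apow1; apply: mem_ideal_mul.
Qed.

Lemma apow_homog n : whomog (least_degree n) (apow n).
Proof.
elim/mnm_ind: n => [|i n IHn]; first by rewrite apow0 least_degree0; apply: dhomog1.
by rewrite apowD apow1 least_degreeD least_degree1; apply: dhomogM.
Qed.

Lemma apow_neq0 n : apow n != 0.
Proof. by apply/prodf_neq0 => i _; apply: expf_neq0. Qed.

Definition ones : 'X_{1..r} := [multinom 1%N | i < r].

Lemma least_degree_ones : least_degree ones = (\sum_(i < r) e i)%N.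
Proof. by rewrite /least_degree; apply: eq_bigr => i _; rewrite mnmE muln1. Qed.

(** The colons [(I ^^ (n + ones) : apow n)] grow with [n], and are proper since
    [apow n] has too small a degree to lie in [I ^^ (n + ones)]. Once they are
    constant, an associated prime of their common value is the annihilator of
    [g * apow n] for all large [n], with the same [g]. *)
Lemma prime_witness_bounded : (0 < least_degree ones)%N -> exists t m,
  forall n, (m <= n)%MM -> exists x, prime_witness f I e ones t n x.
Proof.
move=> ones_gt0; pose J n := colon (I ^^ (n + ones)%MM) (apow n).
have J1 n : ~ J n 1.
  rewrite /= mul1r => Ia.
  have := homog_initial_le (apow_neq0 n) (apow_homog n) (mexp_initial I_initial Ia).
  by rewrite least_degreeD leqNgt -{1}[least_degree n]addn0 ltn_add2l ones_gt0.
have Jmono m n x : (m <= n)%MM -> J m x -> J n x.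
  move=> /submK <- /= Jx; rewrite apowD mulrCA -addmA.
  by apply: mem_mexpM => //; apply: mem_apow.
have [|m _ mmax] := noetherian_max J (P := fun=> True) nR.
  by exists 0%MM.
have Jstable n : (m <= n)%MM -> J n = J m.
  move=> mn; apply: ideal_ext => x; split; last exact: Jmono.
  by apply: mmax => // y; apply: Jmono.
have Jhomog : homogeneous_ideal f (J m).
  move=> x k /= Jx; have := mexp_homog I_homog (least_degree m + k) Jx.
  by rewrite mulrC (hpart_homogM _ _ (apow_homog m)) leq_addr addKn mulrC.
(* a homogeneous [g] outside [J m] with [(J m : g)] maximal: the colon is then
   unchanged when [g] is multiplied by a homogeneous element outside it *)
pose G := {g : nat * R | whomog g.1 g.2}.
have [|[[t g] /= hg] Jg gmax] := noetherian_max
  (fun g : G => colon (J m) (sval g).2)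
  (P := fun g : G => ~ J m (sval g).2) nR.
  by exists (exist _ (0%N, 1) (dhomog1 _ _)); apply: J1.
have pg : prime_ideal (colon (J m) g).
  apply: (homogeneous_prime (f := f)) => [x k|/=|k b h hh].
  - move=> Jxg; have := Jhomog (x * g) (t + k)%N Jxg.
    by rewrite mulrC (hpart_homogM _ _ hg) leq_addr addKn mulrC.
  - by rewrite mul1r.
  - move=> Jbh; have [|Jh] := pselect (colon (J m) g h); [by right|left].
    have hgh : whomog (k + t) (h * g) by apply: dhomogM.
    apply: (gmax (exist _ ((k + t)%N, h * g) hgh)) => //=.
      by move=> c Jc; rewrite mulrCA -mulrA; apply: idealM.
    by rewrite mulrA.
exists t, m => n mn; exists (g * apow n); split.
- by apply: idealM; apply: mem_apow.
- by rewrite addnC; apply: dhomogM => //; apply: apow_homog.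
- suff -> : ann I ones n (g * apow n) = colon (J m) g by [].
  by rewrite -(Jstable _ mn); apply: ideal_ext => x; rewrite /= mulrA.
Qed.

(** A prime containing [I ^^ n] contains some [I i], so that [ratliff] applies. *)
Lemma prime_colon_mem : exists k, forall n x, (k <= n)%MM ->
  prime_ideal (colon (I ^^ n) x) ->
  exists2 i, (U_(i) <= n)%MM & (I ^^ (n - U_(i))%MM) x.
Proof.
have /choice[k kP] : forall i, exists k, forall n x, (k <= n)%MM ->
    (forall b, I i b -> (I ^^ (U_(i) + n)%MM) (b * x)) -> (I ^^ n) x.
  by move=> i; apply: ratliff => //; exists (a i).
exists [multinom (\sum_(i < r) k i j).+1 | j < r]; move=> n x /mnm_lepP kn px.
have [|i ni Iix] := mexp_prime (I := I) (m := n) px.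
  by move=> y Iy; rewrite /= mulrC; apply: idealM.
have le_in : (U_(i) <= n)%MM.
  by apply/mnm_lepP => l; rewrite mnm1E; case: eqP => // <-.
exists i => //; apply: (kP i) => [|b /Iix]; last by rewrite addmC submK.
apply/mnm_lepP => l; rewrite mnmBE mnm1E; have := kn l.
by rewrite mnmE (bigD1 i) //=; case: (i == l) => /=; lia.
Qed.

(** The excess over [least_degree] of the least [k] such that [T n k] is bounded
    below by the first hypothesis, above by the second, and by the third does
    not increase along the coordinate directions; so its least value is kept
    from where it is first attained. *)
Lemma eventually_min_linear (T : 'X_{1..r} -> nat -> Prop) (D : nat) :
  (exists m, forall n, (m <= n)%MM -> forall k, T n k -> (least_degree n <= k + D)%N) ->
  (exists c m, forall n, (m <= n)%MM -> exists2 k, T n k & (k <= least_degree n + c)%N) ->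
  (forall c, exists m, forall n, (m <= n)%MM -> forall j k, (k <= least_degree n + c)%N ->
     T n k -> T (U_(j) + n)%MM (k + e j)%N) ->
  exists (c : int) m, forall n, (m <= n)%MM -> exists k : nat,
    [/\ T n k, forall l, T n l -> (k <= l)%N & k%:Z = (least_degree n)%:Z + c].
Proof.
move=> [m1 H1] [c [m2 H2]] /(_ c)[m3 H3].
pose m := (m1 + m2 + m3)%MM.
have m_le n : (m <= n)%MM -> [/\ (m1 <= n)%MM, (m2 <= n)%MM & (m3 <= n)%MM].
  move=> /mnm_lepP mn; split; apply/mnm_lepP => i; have := mn i;
    rewrite !mnmDE; lia.
(* [delta] is the excess shifted by [D], hence natural *)
pose P delta := `[< exists2 n, (m <= n)%MM &
  exists2 k, T n k & (k + D = least_degree n + delta)%N >].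
have [delta1 d1c Pdelta1] : exists2 delta, (delta <= c + D)%N & P delta.
  have [m1m m2m _] := m_le m (lepm_refl m).
  have [k Tk kc] := H2 m m2m; have km := H1 m m1m k Tk.
  exists (k + D - least_degree m)%N; first lia.
  by apply/asboolP; exists m; rewrite ?lepm_refl //; exists k => //; lia.
have exP : exists delta, P delta by exists delta1.
case: (ex_minnP exP) => delta /asboolP[n0 mn0 Tn0] dmin.
have dc : (delta <= c + D)%N by apply: leq_trans d1c; apply: dmin.
exists (delta%:Z - D%:Z), n0 => n n0n.
have mn : (m <= n)%MM by apply: lepm_trans n0n.
have [k Tk kE] : exists2 k, T n k & (k + D = least_degree n + delta)%N.
  rewrite -(submK n0n); elim/mnm_ind: (n - n0)%MM => [|i l [k Tk kE]].
    by rewrite add0m.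
  have [|_ _ m3l] := m_le (l + n0)%MM.
    by apply: lepm_trans mn0 _; apply: lem_addl.
  exists (k + e i)%N; first by rewrite -addmA; apply: H3 => //; lia.
  by rewrite -addmA least_degreeD least_degree1; lia.
exists k; split=> //; last lia.
move=> l Tl; have [m1n _ _] := m_le n mn; have ln := H1 n m1n l Tl.
have : P (l + D - least_degree n)%N.
  by apply/asboolP; exists n => //; exists l => //; lia.
by move/dmin; lia.
Qed.

End Stabilisation.

(** * Asymptotic linearity *)

Lemma einf_eq (S : set (\bar int)) y :
  (forall x, S x -> (y <= x)%E) -> (forall z, (forall x, S x -> (z <= x)%E) -> (z <= y)%E) ->
  einf S = y.
Proof.
move=> lby gy; have [lbS glbS] := einf_glb S.
by apply: le_anti; rewrite glbS // andbT gy.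
Qed.

Lemma einf_min (S : set int) k : S k -> (forall l, S l -> k <= l) ->
  einf [set l%:E | l in S]%classic = k%:E.
Proof.
move=> Sk kmin; apply: einf_eq => [x [l Sl <-]|z zS].
  by rewrite lee_fin kmin.
by apply: zS; exists k.
Qed.

Section Gradings.
Variables (A : comNzRingType) (L : lmodType A) (gr : grading L).

Lemma indeg_min k : (exists2 x, gr k x & x <> 0) ->
  (forall l x, gr l x -> x <> 0 -> k <= l) -> indeg gr = k%:E.
Proof. by move=> kx kmin; apply: einf_min => // l [x]; apply: kmin. Qed.

(** Any [x] whose annihilator is a prime ideal makes it an associated prime: the
    double infimum is a minimum over such [x]. *)
Lemma vnumber_min k (p : ideal A) x :
  prime_ideal p -> gr k x -> submodule_set p = ann_set x ->
  (forall l (q : ideal A) y, prime_ideal q -> gr l y -> submodule_set q = ann_set y -> k <= l) ->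
  vnumber gr = k%:E.
Proof.
move=> pp kx px kmin.
have local_min q : prime_ideal q -> (k%:E <= local_vnumber gr q)%E.
  move=> pq; have [_] := einf_glb [set l%:E |
    l in [set l | exists2 y, gr l y & submodule_set q = ann_set y]]%classic.
  by apply=> _ [l [y ly qy] <-]; rewrite lee_fin; apply: kmin ly qy.
apply: einf_eq => [_ [q [pq _] <-]|z zle]; first exact: local_min.
have <- : local_vnumber gr p = k%:E.
  apply: einf_min => [|l [y ly py]]; first by exists x.
  exact: kmin ly py.
by apply: zle; exists p => //; split=> //; exists x.
Qed.

End Gradings.

Lemma quotmod_pi_eq0 (A : comNzRingType) (V : lmodType A) (N : submodule V) (x : V) :
  (\pi_(quotmod N) x)%qT = 0 <-> N x.
Proof.
have -> : (0 : quotmod N) = (\pi_(quotmod N) 0)%qT by rewrite raddf0.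
by rewrite quotmod_eqE subr0.
Qed.

Lemma ann_quot (A : comNzRingType) (K : ideal A) x :
  ann_set (\pi_(quotmod K) x)%qT = submodule_set (colon K x).
Proof.
apply/funext => a; apply/propext; rewrite /ann_set -quotmod_piZ.
by rewrite quotmod_pi_eq0.
Qed.

Lemma ann_subquot (A : comNzRingType) (J K : ideal A) (y : submod J) :
  ann_set (\pi_(quotmod (submod_restrict J K)) y)%qT = submodule_set (colon K (val y)).
Proof.
apply/funext => a; apply/propext; rewrite /ann_set -quotmod_piZ.
by rewrite quotmod_pi_eq0.
Qed.

Lemma vnumber_quot_grading_min (A : comNzRingType) (V : lmodType A) (gr : grading V)
    (N : submodule V) k (p : ideal A) x :
  prime_ideal p -> gr k x -> submodule_set p = ann_set (\pi_(quotmod N) x)%qT ->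
  (forall l (q : ideal A) y, prime_ideal q -> gr l y ->
     submodule_set q = ann_set (\pi_(quotmod N) y)%qT -> k <= l) ->
  vnumber (quot_grading gr N) = k%:E.
Proof.
move=> pp kx px kmin; apply: vnumber_min pp _ px _; first by exists x.
by move=> l q _ pq [y ly <-]; apply: kmin.
Qed.

Lemma indeg_quot_grading_min (A : comNzRingType) (V : lmodType A) (gr : grading V)
    (N : submodule V) k x :
  gr k x -> ~ N x -> (forall l y, gr l y -> ~ N y -> k <= l) ->
  indeg (quot_grading gr N) = k%:E.
Proof.
move=> kx Nx kmin; apply: indeg_min.
  by exists (\pi_(quotmod N) x)%qT; [exists x|move/quotmod_pi_eq0].
by move=> l _ [y ly <-] piy; apply: (kmin l y) => // /quotmod_pi_eq0.
Qed.

Section MpolyGradings.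
Variables (R0 : idomainType) (d : nat) (f : 'I_d -> nat).
Local Notation R := {mpoly R0[d]}.
Local Notation whomog k p := (p \is k.-homog for (wdeg f)).
Implicit Types (J K : ideal R) (x : R).

Lemma mpoly_gradingP (k : int) x : x != 0 ->
  mpoly_grading f k x -> exists2 l : nat, k = l & whomog l x.
Proof. by case: k => [l|l] x0 /=; [exists l|move=> x00; rewrite x00 eqxx in x0]. Qed.

Lemma indeg_ideal_min J (k : nat) x : J x -> whomog k x -> x != 0 ->
  (forall y, J y -> initial_ideal f k y) -> indeg_ideal f J = (Posz k)%:E.
Proof.
move=> Jx hx x0 kmin; apply: indeg_min.
  exists (exist _ x (asboolT Jx)) => // /(congr1 val) /= /eqP.
  by rewrite (negPf x0).
move=> l y ly /eqP y0; have {}y0 : val y != 0 by apply: contra y0 => /eqP y0; apply/eqP/val_inj.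
have [l' -> /(homog_initial_le y0)] := mpoly_gradingP y0 ly; apply; apply: kmin.
exact/asboolP/(valP y).
Qed.

Lemma vnumber_quot_min K (k : nat) x :
  whomog k x -> prime_ideal (colon K x) ->
  (forall l y, whomog l y -> prime_ideal (colon K y) -> (k <= l)%N) ->
  vnumber_quot f K = (Posz k)%:E.
Proof.
move=> hx px kmin.
apply: (vnumber_quot_grading_min px _ (esym (ann_quot K x))) => // l q y pq ly.
rewrite ann_quot => qE.
have {}qE : q = colon K y by apply: ideal_ext => z; rewrite qE.
rewrite qE in pq; have y0 := prime_colon_neq0 pq.
by have [l' -> hy] := mpoly_gradingP y0 ly; apply: kmin hy pq.
Qed.

Lemma vnumber_subquot_min J K (k : nat) x :
  J x -> whomog k x -> prime_ideal (colon K x) ->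
  (forall l y, J y -> whomog l y -> prime_ideal (colon K y) -> (k <= l)%N) ->
  vnumber_subquot f J K = (Posz k)%:E.
Proof.
move=> Jx hx px kmin; pose x' : submod J := exist _ x (asboolT Jx).
apply: (vnumber_quot_grading_min px _ (esym (ann_subquot K x'))) => // l q y pq ly.
rewrite ann_subquot => qE.
have {}qE : q = colon K (val y) by apply: ideal_ext => z; rewrite qE.
rewrite qE in pq; have y0 := prime_colon_neq0 pq.
have [l' -> hy] := mpoly_gradingP y0 ly; apply: kmin hy pq.
exact/asboolP/(valP y).
Qed.

Lemma indeg_subquot_min J K (k : nat) x :
  J x -> whomog k x -> ~ K x -> (forall y, J y -> initial_ideal f k y) ->
  indeg_subquot f J K = (Posz k)%:E.
Proof.
move=> Jx hx Kx kmin; pose x' : submod J := exist _ x (asboolT Jx).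
apply: (indeg_quot_grading_min (x := x')) => // l y ly Ky.
have y0 : val y != 0 by apply/eqP => y0; apply: Ky; rewrite /= y0; apply: submodule0.
have [l' -> /(homog_initial_le y0)] := mpoly_gradingP y0 ly; apply; apply: kmin.
exact/asboolP/(valP y).
Qed.

End MpolyGradings.

Lemma ideal_initial_degree (R0 : idomainType) (d : nat) (f : 'I_d -> nat)
    (J : ideal {mpoly R0[d]}) :
  homogeneous_ideal f J -> (exists2 x, J x & x <> 0) ->
  exists k : nat, (forall x, J x -> initial_ideal f k x) /\
    exists a, [/\ J a, a \is k.-homog for (wdeg f) & a != 0].
Proof.
move=> hJ [x Jx x0].
have ex : exists k, `[< exists2 y, J y & pihomog (wdeg f) k y <> 0 >].
  apply: contrapT => no; apply: x0; apply: (hpart_eq0 (f := f)) => k.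
  by apply: contrapT => xk; apply: no; exists k; apply/asboolP; exists x.
case: (ex_minnP ex) => k /asboolP[y Jy yk] kmin; exists k; split.
  move=> z Jz i ik; apply: contrapT => zi; move: ik; rewrite ltnNge kmin //.
  by apply/asboolP; exists z.
exists (pihomog (wdeg f) k y); split; [exact: hJ|exact: pihomogP|exact/eqP].
Qed.

Lemma eventually_linear_multinom r (e : 'I_r -> nat) (F : ('I_r -> nat) -> \bar int) :
  (exists (c : int) (m : 'X_{1..r}), forall n : 'X_{1..r}, (m <= n)%MM ->
     F (fun_of_multinom n) = ((least_degree e n)%:Z + c)%:E) ->
  eventually_linear (fun i => (e i)%:Z) F.
Proof.
move=> [c [m Fm]]; exists c, (fun_of_multinom m) => n mn.
pose n' := [multinom n i | i < r].
have nE : fun_of_multinom n' = n by apply/funext => i; rewrite mnmE.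
rewrite -{1}nE Fm; last by apply/mnm_lepP => i; rewrite nE.
rewrite /least_degree (big_morph Posz PoszD (erefl _)); congr (_ + _)%:E.
by apply: eq_bigr => i _; rewrite nE PoszM.
Qed.

Theorem theorem1p7 (R0 : idomainType) (R0_noetherian : noetherian R0)
    (d : nat) (f : 'I_d -> nat) (r : nat) (I : 'I_r -> ideal {mpoly R0[d]})
    (I_neq0 : forall i : 'I_r, exists2 x : {mpoly R0[d]}, I i x & x <> 0)
    (I_homog : forall i : 'I_r, homogeneous_ideal f (I i))
    (I_indeg : exists i : 'I_r, (1%:E <= indeg_ideal f (I i))%E) :
  exists2 e : 'I_r -> int,
    forall i : 'I_r, indeg_ideal f (I i) = (e i)%:E &
    [/\ eventually_linear e
          (fun n => vnumber_quot f (ideal_mexp I n)),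
        eventually_linear e
          (fun n => vnumber_subquot f (ideal_mexp I n)
                      (ideal_mexp I (fun i => (n i).+1))) &
        eventually_linear e
          (fun n => indeg_subquot f (ideal_mexp I n)
                      (ideal_mexp I (fun i => (n i).+1)))].
Proof.
have nR := mpoly_noetherian (d := d) R0_noetherian.
have /choice[e eP] := fun i => ideal_initial_degree (I_homog i) (I_neq0 i).
have I_initial i x : I i x -> initial_ideal f (e i) x by case: (eP i) => + _; apply.
have /choice[a aP] : forall i, exists b,
    [/\ I i b, b \is (e i).-homog for (wdeg f) & b != 0].
  by move=> i; case: (eP i).
have a_in i : I i (a i) by case: (aP i).
have a_homog i : a i \is (e i).-homog for (wdeg f) by case: (aP i).
have a_neq0 i : a i != 0 by case: (aP i).
have indegE i : indeg_ideal f (I i) = (e i)%:Z%:E.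
  by apply: (indeg_ideal_min (a_in i) (a_homog i) (a_neq0 i)) => x; apply: I_initial.
have ones_gt0 : (0 < least_degree e (ones r))%N.
  have [i] := I_indeg; rewrite indegE lee_fin lez_nat => ei.
  by rewrite least_degree_ones (bigD1 i) //= (leq_trans ei) // leq_addr.
have succE (n : 'X_{1..r}) : ideal_mexp I (fun i => (n i).+1) = ideal_mexp I (n + ones r)%MM.
  by congr ideal_mexp; apply/funext => i; rewrite mnmDE mnmE addn1.
have [t [m0 upper]] := prime_witness_bounded nR I_homog I_initial a_in a_homog
  a_neq0 ones_gt0.
exists (fun i => (e i)%:Z) => //; split; apply: eventually_linear_multinom.
(* [x] lies in [I ^^ (n - U_(i))] for some [i], whence the shift by [D >= e i] *)
- have [m1 memP] := prime_colon_mem nR a_in a_neq0.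
  pose D := (\sum_(i < r) e i)%N.
  have [|||c [m mP]] := eventually_min_linear (e := e) (D := D)
    (T := fun n k => exists2 x, x \is k.-homog for (wdeg f) &
       prime_ideal (colon (ideal_mexp I (fun_of_multinom n)) x)).
  + exists m1 => n m1n k [x hx px]; have [i le_in Ix] := memP n x m1n px.
    have := homog_initial_le (prime_colon_neq0 px) hx (mexp_initial I_initial Ix).
    have : least_degree e n = (least_degree e (n - U_(i))%MM + e i)%N.
      by rewrite -(least_degree1 e i) -least_degreeD submK.
    by rewrite /D (bigD1 i) //=; lia.
  + exists t, (m0 + ones r)%MM => n le_n.
    have on : (ones r <= n)%MM by apply: lepm_trans le_n; apply: lem_addl.
    have [|x [_ hx px]] := upper (n - ones r)%MM.
      apply/mnm_lepP => i; move/mnm_lepP/(_ i): le_n; rewrite mnmDE mnmBE; lia.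
    exists (least_degree e (n - ones r)%MM + t)%N.
      by exists x => //; rewrite /ann submK in px.
    by rewrite -[in leqRHS](submK on) least_degreeD -addnA leq_add2l addnC leq_addr.
  + move=> c.
    have /choice[N NP] := fun i => prime_witness_persists nR I_homog I_initial U_(i)%MM (c + D).
    exists (m1 + [multinom (\sum_(i < r) N i).+1 | j < r])%MM => n le_n j k kc [x hx px].
    have m1n : (m1 <= n)%MM by apply: lepm_trans le_n; apply: lem_addr.
    have [i le_in Ix] := memP n x m1n px.
    have nE : least_degree e n = (least_degree e (n - U_(i))%MM + e i)%N.
      by rewrite -(least_degree1 e i) -least_degreeD submK.
    have kge := homog_initial_le (prime_colon_neq0 px) hx (mexp_initial I_initial Ix).
    have eD : (e i <= D)%N by rewrite /D (bigD1 i) //= leq_addr.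
    have [|||y [_ hy py]] := NP i (n - U_(i))%MM _ j (k - least_degree e (n - U_(i))%MM)%N x.
    * move=> l; move/mnm_lepP/(_ l): le_n; rewrite mnmBE mnmDE mnmE mnm1E (bigD1 i) //=.
      by case: (i == l) => /=; lia.
    * by move: kc; rewrite nE; lia.
    * split=> //; first by rewrite subnKC.
      by rewrite /ann submK.
    exists y; last by rewrite /ann -addmA submK in py.
    move: hy; rewrite least_degreeD least_degree1.
    by have -> : (e j + least_degree e (n - U_(i))%MM + (k - least_degree e (n - U_(i))%MM) = k + e j)%N by lia.
  exists c, m => n /mP[k [[x hx px] kmin <-]].
  by apply: vnumber_quot_min hx px _ => l y hy py; apply: kmin; exists y.
- have [|||c [m mP]] := eventually_min_linear (e := e) (D := 0%N)
    (T := fun n k => exists x, [/\ (ideal_mexp I (fun_of_multinom n)) x,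
       x \is k.-homog for (wdeg f) &
       prime_ideal (colon (ideal_mexp I (fun_of_multinom (n + ones r)%MM)) x)]).
  + exists 0%MM => n _ k [x [Ix hx px]]; rewrite addn0.
    exact: homog_initial_le (prime_colon_neq0 px) hx (mexp_initial I_initial Ix).
  + exists t, m0 => n /upper[x [Ix hx px]].
    by exists (least_degree e n + t)%N => //; exists x.
  + move=> c; have [N NP] := prime_witness_persists nR I_homog I_initial (ones r) c.
    exists [multinom N | j < r] => n le_n j k kc [x [Ix hx px]].
    have kge := homog_initial_le (prime_colon_neq0 px) hx (mexp_initial I_initial Ix).
    have [|||y [Iy hy py]] := NP n _ j (k - least_degree e n)%N x.
    * by move=> l; move/mnm_lepP/(_ l): le_n; rewrite mnmE.
    * by lia.
    * by split=> //; rewrite subnKC.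
    exists y; split=> //; move: hy; rewrite least_degreeD least_degree1.
    by have -> : (e j + least_degree e n + (k - least_degree e n) = k + e j)%N by lia.
  exists c, m => n /mP[k [[x [Ix hx px]] kmin <-]]; rewrite succE.
  by apply: vnumber_subquot_min Ix hx px _ => l y Iy hy py; apply: kmin; exists y.
- exists 0, 0%MM => n _; rewrite addr0 succE.
  apply: indeg_subquot_min (mem_apow a_in n) (apow_homog a_homog n) _ _.
    move=> /(mexp_initial I_initial) Ia.
    have := homog_initial_le (apow_neq0 a_neq0 n) (apow_homog a_homog n) Ia.
    by rewrite least_degreeD leqNgt -{1}[least_degree e n]addn0 ltn_add2l ones_gt0.
  exact: mexp_initial.
Qed.
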